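(* Let $X=\{1,\dots,k\}$ be a finite quandle and $L$ a 1-linkoid. The quandle counting matrix $\Phi^{M_k}_X(L)$ is an invariant of $L$, i.e. equivalent 1-linkoid diagrams have the same quandle counting matrix with respect to $X$.
   Context: A quandle is a set $X$ with a binary operation $\triangleright$ such that (1) $x\triangleright x=x$ for all $x$; (2) for every $y$ the map $\beta_y:X\to X$, $\beta_y(x)=x\triangleright y$, is bijective; (3) $(x\triangleright y)\triangleright z=(x\triangleright z)\triangleright(y\triangleright z)$ for all $x,y,z$. Write $x\triangleright^{-1}y=\beta_y^{-1}(x)$ and $\triangleright^{1}=\triangleright$. A 2-pointed quandle $(X,x_1,x_2)$ is a quandle with an ordered pair of elements (basepoints); homomorphisms of 2-pointed quandles are quandle homomorphisms sending the $i$-th basepoint to the $i$-th basepoint. An oriented 1-linkoid diagram is a generic immersion into $S^2$ of one unit interval $[0,1]$ (oriented from $0$ to $1$; the open component) and a number of oriented circles (closed components), with finitely many transverse double points (crossings), each endowed with over/under information. The image of $0$ in the open component is the leg and the image of $1$ the head; these are the endpoints. Two diagrams are equivalent if they are related by a finite sequence of isotopies in $S^2$ and oriented Reidemeister moves R1, R2, R3, all away from the endpoints (no endpoint is moved over or under a strand); a 1-linkoid is an equivalence class. An arc of a diagram is a maximal piece of a component containing no passage under a crossing (arcs end at undercrossings or endpoints). If $A(L)$ is the set of arcs of $L$, the fundamental quandle $Q(L)$ is the quandle presented by generators $A(L)$ and one relation $r_\tau$ for each crossing $\tau$: if $y$ is the over-arc, $x$ the incoming under-arc, $z$ the outgoing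 under-arc and $\varepsilon\in\{1,-1\}$ the sign of the crossing, then $r_\tau$ is $z=x\triangleright^{\varepsilon}y$. The fundamental pointed quandle is $P(L)=(Q(L),l,h)$, where $l,h$ are the generators of the arcs adjacent to the leg and the head. For a finite quandle $X=\{1,\dots,k\}$, the quandle counting matrix $\Phi^{M_k}_X(L)$ is the $k\times k$ matrix whose $(i,j)$ entry is $\Phi^{\mathbb{Z}}_{(X,i,j)}(L)$, the number of 2-pointed quandle homomorphisms $P(L)\to(X,i,j)$. *)

(* Defs.v *)
From HB Require Import structures.
From mathcomp Require Import all_boot all_order all_algebra all_fingroup.
From mathcomp Require Import finmap.
From mathcomp Require Import all_classical all_reals all_analysis.
From Stdlib Require Import Relation_Operators.
Import Order.TTheory GRing.Theory Num.Theory.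
Import numFieldNormedType.Exports.

Set Implicit Arguments.
Unset Strict Implicit.
Unset Printing Implicit Defensive.

Local Open Scope classical_set_scope.
Local Open Scope ring_scope.

Record quandle (T : Type) := Quandle {
  qop :> T -> T -> T;
  qop_idem : forall x, qop x x = x;
  qop_bij : forall y, bijective (fun x => qop x y);
  qop_dist : forall x y z, qop (qop x y) z = qop (qop x z) (qop y z) }.

Definition pointed_hom (T U : Type) (X : quandle T) (x1 x2 : T)
    (Y : quandle U) (y1 y2 : U) (f : T -> U) : Prop :=
  (forall a b, f (X a b) = Y (f a) (f b)) /\ f x1 = y1 /\ f x2 = y2.

(* [QOpV] stands for the operation x |>^-1 y = beta_y^-1(x). *)
Inductive qterm (G : Type) : Type :=
| QGen of G
| QOp of qterm G & qterm G
| QOpV of qterm G & qterm G.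

Inductive qcong (G : Type) (rel : qterm G -> qterm G -> Prop) :
    qterm G -> qterm G -> Prop :=
| qcong_rel s t : rel s t -> qcong rel s t
| qcong_refl t : qcong rel t t
| qcong_sym s t : qcong rel s t -> qcong rel t s
| qcong_trans s t u : qcong rel s t -> qcong rel t u -> qcong rel s u
| qcong_op s s' t t' :
    qcong rel s s' -> qcong rel t t' -> qcong rel (QOp s t) (QOp s' t')
| qcong_opV s s' t t' :
    qcong rel s s' -> qcong rel t t' -> qcong rel (QOpV s t) (QOpV s' t')
| qcong_idem t : qcong rel (QOp t t) t
| qcong_opK s t : qcong rel (QOpV (QOp s t) t) s
| qcong_opVK s t : qcong rel (QOp (QOpV s t) t) s
| qcong_dist s t u :
    qcong rel (QOp (QOp s t) u) (QOp (QOp s u) (QOp t u)).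

Section PresentedQuandle.
Variables (G : Type) (rel : qterm G -> qterm G -> Prop).

(* The carrier is the quotient of the terms, as a type of congruence classes. *)
Definition presented : Type :=
  {C : set (qterm G) | exists t, C = [set u | qcong rel t u]}.

Definition qclass (t : qterm G) : presented :=
  exist _ [set u | qcong rel t u] (ex_intro _ t erefl).

Definition qrepr (C : presented) : qterm G := sval (cid (svalP C)).

Definition presented_op (C D : presented) : presented :=
  qclass (QOp (qrepr C) (qrepr D)).

Lemma presented_inj (C D : presented) : sval C = sval D -> C = D.
Proof. by case: C D => [C hC] [D hD] /= CD; exact: eq_exist. Qed.

Lemma qclassP s t : qclass s = qclass t <-> qcong rel s t.
Proof.
split=> [/(congr1 sval) /= E|H].
  have: [set u | qcong rel t u] t by exact: qcong_refl.
  by rewrite -E.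
apply: presented_inj => /=; apply/seteqP; split=> u /= Hu.
  exact: qcong_trans (qcong_sym H) Hu.
exact: qcong_trans H Hu.
Qed.

Lemma qreprK C : qclass (qrepr C) = C.
Proof. by apply: presented_inj; rewrite /= /qrepr; case: cid => t /= ->. Qed.

Lemma presented_opE s t : presented_op (qclass s) (qclass t) = qclass (QOp s t).
Proof. by apply/qclassP/qcong_op; apply/qclassP; rewrite qreprK. Qed.

Lemma presented_idem C : presented_op C C = C.
Proof.
by rewrite -[C in LHS]qreprK presented_opE -[RHS]qreprK; apply/qclassP/qcong_idem.
Qed.

Lemma presented_bij D : bijective (fun C => presented_op C D).
Proof.
exists (fun C => qclass (QOpV (qrepr C) (qrepr D))) => C.
  rewrite -[RHS]qreprK; apply/qclassP.
  apply: qcong_trans (qcong_opK rel (qrepr C) (qrepr D)).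
  apply: qcong_opV (qcong_refl _ _).
  by apply/qclassP; rewrite qreprK.
rewrite -{2}(qreprK D) presented_opE -[RHS]qreprK.
exact/qclassP/qcong_opVK.
Qed.

Lemma presented_dist C D E : presented_op (presented_op C D) E =
  presented_op (presented_op C E) (presented_op D E).
Proof.
rewrite -(qreprK C) -(qreprK D) -(qreprK E) !presented_opE.
exact/qclassP/qcong_dist.
Qed.

Definition presented_quandle : quandle presented :=
  Quandle presented_idem presented_bij presented_dist.

End PresentedQuandle.

Section Geometry.
Variable R : realType.

Definition sphere : set 'rV[R]_3 := [set x | \sum_(i < 3) x 0 i ^+ 2 = 1].

Definition det3 (u v w : 'rV[R]_3) : R := \det (\matrix_(i < 3) [:: u; v; w]`_i).

End Geometry.

(* A parameter point of a diagram with [n] closed components: [None] is the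
   open component, parametrised by [0, 1]; [Some i] is a circle R/Z, whose
   points are represented by all their lifts to R. *)
Definition ppoint (R : realType) (n : nat) : Type := (option 'I_n * R)%type.

Section Diagrams.
Variables (R : realType) (n : nat).
Implicit Types (p q : ppoint R n).

Definition in_dom p : Prop := p.1 = None -> 0 <= p.2 <= 1.

Definition shift_pt p (m : int) : ppoint R n := (p.1, p.2 + m%:~R).

Definition same_point p q : Prop :=
  exists m : int, (p.1 = None -> m = 0) /\ q = shift_pt p m.

Definition double_point (g : option 'I_n -> R -> 'rV[R]_3) p q : Prop :=
  [/\ in_dom p, in_dom q, ~ same_point p q & g p.1 p.2 = g q.1 q.2].

Definition leg_pt : ppoint R n := (None, 0).
Definition head_pt : ppoint R n := (None, 1).

(* The over/under information is given by the set [under_pt] of the parameter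
   points at which a strand passes under a crossing. The values of [curve None]
   outside [0, 1] are irrelevant: they only serve to speak of derivatives at
   the endpoints. *)
Record diagram := Diagram {
  curve : option 'I_n -> R -> 'rV[R]_3;
  under_pt : set (ppoint R n);
  curve_sphere : forall p, in_dom p -> sphere (curve p.1 p.2);
  curve_periodic : forall i t, curve (Some i) (t + 1) = curve (Some i) t;
  curve_derivable : forall p, in_dom p -> derivable (curve p.1) p.2 1;
  curve_C1 : forall p, in_dom p -> {for p.2, continuous (derive1 (curve p.1))};
  curve_immersed : forall p, in_dom p -> derive1 (curve p.1) p.2 != 0;
  curve_transverse : forall p q, double_point curve p q ->
    det3 (derive1 (curve p.1) p.2) (derive1 (curve q.1) q.2) (curve p.1 p.2) != 0;
  curve_no_triple : forall p q r,
    double_point curve p q -> double_point curve p r -> same_point q r;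
  curve_finite : finite_set
    [set x | exists p q, double_point curve p q /\ x = curve p.1 p.2];
  curve_leg : forall q, ~ double_point curve leg_pt q;
  curve_head : forall q, ~ double_point curve head_pt q;
  under_double : forall p, under_pt p -> exists q, double_point curve p q;
  under_one : forall p q, double_point curve p q -> (under_pt p <-> ~ under_pt q) }.

Definition ev (D : diagram) p : 'rV[R]_3 := curve D p.1 p.2.

Definition velocity (D : diagram) p : 'rV[R]_3 := derive1 (curve D p.1) p.2.

Definition crossing (D : diagram) (o u : ppoint R n) : Prop :=
  double_point (curve D) o u /\ under_pt D u.

(* The sphere is oriented by its outward normal: seen from outside, the
   crossing is positive when turning counterclockwise from the over-strand to
   the under-strand, both with their directions. *)
Definition positive_crossing (D : diagram) (o u : ppoint R n) : bool :=
  0 < det3 (velocity D o) (velocity D u) (ev D o).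

(* [p] and [q] are joined by a piece of a component without undercrossing,
   going from [p] to the lift of [q] shifted by [m]. *)
Definition joined (D : diagram) p q : Prop :=
  p.1 = q.1 /\ exists m : int, (p.1 = None -> m = 0) /\
    forall t : R,
      Num.min p.2 (shift_pt q m).2 <= t <= Num.max p.2 (shift_pt q m).2 ->
      ~ under_pt D (p.1, t).

Definition arc_through (D : diagram) p : set (ppoint R n) :=
  [set q | in_dom q /\ joined D p q].

(* An arc is encoded by the set of its parameter points, without the
   undercrossings at its ends. *)
Definition diag_arc (D : diagram) : Type :=
  {A : set (ppoint R n) |
    exists p, [/\ in_dom p, ~ under_pt D p & A = arc_through D p]}.

Lemma in_dom_leg : in_dom leg_pt.
Proof. by move=> _; rewrite lexx ler01. Qed.

Lemma in_dom_head : in_dom head_pt.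
Proof. by move=> _; rewrite lexx ler01. Qed.

Lemma not_under_leg (D : diagram) : ~ under_pt D leg_pt.
Proof. by move=> /under_double[q /curve_leg]. Qed.

Lemma not_under_head (D : diagram) : ~ under_pt D head_pt.
Proof. by move=> /under_double[q /curve_head]. Qed.

Definition leg_arc (D : diagram) : diag_arc D :=
  exist _ (arc_through D leg_pt)
    (ex_intro _ leg_pt (And3 in_dom_leg (@not_under_leg D) erefl)).

Definition head_arc (D : diagram) : diag_arc D :=
  exist _ (arc_through D head_pt)
    (ex_intro _ head_pt (And3 in_dom_head (@not_under_head D) erefl)).

Definition over_arc (D : diagram) (o : ppoint R n) (y : diag_arc D) : Prop :=
  sval y o.

Definition incoming_arc (D : diagram) (u : ppoint R n) (x : diag_arc D) : Prop :=
  \forall t \near u.2^'-, sval x (u.1, t).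

Definition outgoing_arc (D : diagram) (u : ppoint R n) (z : diag_arc D) : Prop :=
  \forall t \near u.2^'+, sval z (u.1, t).

Inductive crossing_relation (D : diagram) :
    qterm (diag_arc D) -> qterm (diag_arc D) -> Prop :=
| CrossingRelation o u (x y z : diag_arc D) :
    crossing D o u -> over_arc o y -> incoming_arc u x -> outgoing_arc u z ->
    crossing_relation (QGen z)
      (if positive_crossing D o u then QOp (QGen x) (QGen y)
       else QOpV (QGen x) (QGen y)).

Definition fundamental_carrier (D : diagram) : Type :=
  presented (@crossing_relation D).

Definition fundamental_quandle (D : diagram) : quandle (fundamental_carrier D) :=
  presented_quandle (@crossing_relation D).

Definition leg_generator (D : diagram) : fundamental_carrier D :=
  qclass (@crossing_relation D) (QGen (leg_arc D)).

Definition head_generator (D : diagram) : fundamental_carrier D :=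
  qclass (@crossing_relation D) (QGen (head_arc D)).

(* The set counted here is finite, since the target is finite and a diagram
   has finitely many arcs. *)
Definition counting_invariant (k : nat) (X : quandle 'I_k) (i j : 'I_k)
    (D : diagram) : nat :=
  #|` fset_set [set f : fundamental_carrier D -> 'I_k |
        pointed_hom (fundamental_quandle D) (leg_generator D) (head_generator D)
          X i j f]|%fset.

Definition counting_matrix (k : nat) (X : quandle 'I_k) (D : diagram) :
    'M[nat]_k :=
  \matrix_(i < k, j < k) counting_invariant X i j D.

(* A diagram is an immersion considered up to the choice of the numbering of
   its closed components and of orientation preserving parametrisations. *)
Definition reparametrised (D D' : diagram) : Prop :=
  exists (s : 'S_n) (rho : option 'I_n -> R -> R),
    let tr p : ppoint R n := (omap s p.1, rho p.1 p.2) in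
    [/\ rho None 0 = 0 /\ rho None 1 = 1,
        forall i t, rho (Some i) (t + 1) = rho (Some i) t + 1,
        forall p, in_dom p ->
          [/\ derivable (rho p.1) p.2 1,
              {for p.2, continuous (derive1 (rho p.1))} &
              0 < derive1 (rho p.1) p.2],
        forall p, in_dom p -> ev D' p = ev D (tr p) &
        forall p, in_dom p -> (under_pt D' p <-> under_pt D (tr p))].

(* An ambient C^1 isotopy of the sphere. As usual for maps on a subset of R^3,
   each [H t] is differentiable on the sphere in the sense that it extends
   differentiably to a neighbourhood of it. *)
Definition sphere_isotopy (H : R -> 'rV[R]_3 -> 'rV[R]_3) : Prop :=
  let dom := [set z : R * 'rV[R]_3 | 0 <= z.1 <= 1 /\ sphere z.2] in
  [/\ forall x, sphere x -> H 0 x = x,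
      forall t : R, 0 <= t <= 1 -> set_bij (@sphere R) (@sphere R) (H t),
      {within dom, continuous (fun z => H z.1 z.2)},
      forall (t : R) x, 0 <= t <= 1 -> sphere x ->
        differentiable (H t) x /\
        forall v : 'rV[R]_3,
          \sum_(i < 3) x 0 i * v 0 i = 0 -> 'd (H t) x v = 0 -> v = 0 &
      forall v : 'rV[R]_3,
        {within dom, continuous (fun z : R * 'rV[R]_3 => 'd (H z.1) (z.2) v)}].

Definition isotopic (D D' : diagram) : Prop :=
  exists H, [/\ sphere_isotopy H,
    forall p, in_dom p -> ev D' p = H 1 (ev D p) &
    forall p, under_pt D' p <-> under_pt D p].

Definition sym_itv : set R := [set u | -1 <= u <= 1].

Definition square : set (R * R) :=
  [set z | sym_itv z.1 /\ sym_itv z.2].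

(* An orientation preserving C^1 embedding of [-1, 1]^2 into the sphere: its
   image is the disk in which a Reidemeister move takes place. *)
Definition disk_chart (phi : R * R -> 'rV[R]_3) : Prop :=
  [/\ forall z, square z -> sphere (phi z),
      set_inj square phi,
      forall z, square z -> differentiable phi z,
      forall v : R * R, {within square, continuous (fun z => 'd phi z v)} &
      forall z, square z -> 0 < det3 ('d phi z (1, 0)) ('d phi z (0, 1)) (phi z)].

(* A picture consists of [m] strands in the square, each parametrised by
   [-1, 1], with a height function deciding which strand is over. *)
Definition picture (m : nat) : Type := 'I_m -> R -> R * R.

(* Strand [i] occupies the parameters [strand_mid i + u * strand_rad i], with u
   in [-1, 1], of the component [strand_comp i]; if [strand_rad i] is negative,
   the component runs through the strand backwards. *)
Record placement (m : nat) := Placement {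
  strand_comp : 'I_m -> option 'I_n;
  strand_mid : 'I_m -> R;
  strand_rad : 'I_m -> R }.

Definition place m (pl : placement m) (i : 'I_m) (u : R) : ppoint R n :=
  (strand_comp pl i, strand_mid pl i + u * strand_rad pl i).

Definition placement_ok m (pl : placement m) : Prop :=
  (forall i u, sym_itv u -> strand_comp pl i = None ->
     0 < strand_mid pl i + u * strand_rad pl i < 1) /\
  (forall i j u v, sym_itv u -> sym_itv v ->
     same_point (place pl i u) (place pl j v) -> i = j /\ u = v).

Definition on_strands m (pl : placement m) p : Prop :=
  exists i u, sym_itv u /\ same_point (place pl i u) p.

Definition shows (D : diagram) m (phi : R * R -> 'rV[R]_3) (pl : placement m)
    (pic : picture m) (hgt : 'I_m -> R -> R) : Prop :=
  [/\ forall i u, sym_itv u -> ev D (place pl i u) = phi (pic i u),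
      forall p, in_dom p -> (phi @` square) (ev D p) -> on_strands pl p &
      forall i j u v, sym_itv u -> sym_itv v ->
        double_point (curve D) (place pl i u) (place pl j v) ->
        (under_pt D (place pl i u) <-> hgt i u < hgt j v)].

(* [D'] is obtained from [D] by replacing, in some disk of the sphere, the
   picture [pre] by the picture [post], everything else being left untouched.
   No endpoint lies in the disk, by [placement_ok] and [shows]. *)
Definition local_move m (pre post : picture m) (hgt : 'I_m -> R -> R)
    (D D' : diagram) : Prop :=
  exists phi (pl : placement m),
    [/\ disk_chart phi, placement_ok pl,
        shows D phi pl pre hgt, shows D' phi pl post hgt &
        forall p, in_dom p -> ~ on_strands pl p ->
          ev D' p = ev D p /\ (under_pt D' p <-> under_pt D p)].

(* In the pictures below, [hump] and its derivative vanish at -1 and 1, so that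
   the two sides of a move agree to first order on the boundary of the square,
   and [hump u = 1] exactly for u = -1/2 and u = 1/2 in [-1, 1], which is where
   the crossings of R1 and R2 and those of the third strand in R3 are. *)
Definition hump (u : R) : R := 16 / 9 * (1 - u ^+ 2) ^+ 2.

Definition R1_pre : picture 1 := fun _ u => (u, 0).
Definition R1_post : picture 1 := fun _ u => (u * (1 - hump u), hump u / 2).

Definition R2_pre : picture 2 := fun i u => (u, (-1) ^+ i / 2).
Definition R2_post : picture 2 := fun i u => (u, (-1) ^+ i * (1 - hump u) / 2).

Definition R3_pre : picture 3 := fun i u =>
  (u, [:: u / 2; - (u / 2); hump u / 4]`_i).
Definition R3_post : picture 3 := fun i u =>
  (u, [:: u / 2; - (u / 2); - (hump u / 4)]`_i).

Definition reidemeister1 (D D' : diagram) : Prop :=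
  exists b : bool, local_move R1_pre R1_post (fun _ u => (-1) ^+ b * u) D D'.

Definition reidemeister2 (D D' : diagram) : Prop :=
  exists h : 'I_2 -> R, injective h /\
    local_move R2_pre R2_post (fun i _ => h i) D D'.

Definition reidemeister3 (D D' : diagram) : Prop :=
  exists h : 'I_3 -> R, injective h /\
    local_move R3_pre R3_post (fun i _ => h i) D D'.

Definition elementary (D D' : diagram) : Prop :=
  [\/ reparametrised D D', isotopic D D' |
      [\/ reidemeister1 D D', reidemeister2 D D' | reidemeister3 D D']].

Definition linkoid_equiv : diagram -> diagram -> Prop :=
  clos_refl_sym_trans diagram elementary.

End Diagrams.

(* Main.v *)
Require Import Defs.
From mathcomp Require Import all_boot all_order all_algebra all_fingroup.
From mathcomp Require Import finmap.
From mathcomp Require Import all_classical all_reals all_analysis.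
From mathcomp Require Import ring lra.
Import Order.TTheory GRing.Theory Num.Theory.
Import numFieldNormedType.Exports.

(** A homomorphism out of the fundamental quandle of a diagram is determined by
    the images of the arcs, which may be chosen freely subject to the crossing
    relations. It is thus a coloring of the diagram by X: a function on the
    parameter points other than undercrossings that is constant along arcs and
    satisfies z = x |>^e y at each crossing ([homs_colorings_card]). The (i, j)
    entry of the counting matrix counts the colorings with value i at the leg
    and j at the head, so each elementary move only has to come with a bijection
    between the colorings of the two diagrams.

    Reparametrisations and isotopies identify the parameter points of the two
    diagrams in a way that respects undercrossings and signs of crossings, and
    colorings are pulled back along this identification ([iso_colorings_card]).
    For an isotopy H the point is the sign: if v and w are the velocities of
    the two strands at a crossing x, the determinant of dH_t v, dH_t w and
    H_t x depends continuously on t and never vanishes, because dH_t is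
    injective on the tangent plane ([isotopy_sign]).

    A Reidemeister move changes the diagram inside a disk only, where the
    diagram consists of m strands. All crossings of all pictures occur at the
    parameters -1/2, 0 and 1/2 of the strands, which divide each strand into
    four zones; inside the disk a coloring is a color for each zone, subject to
    one equation for each strand and each of the three parameters
    ([restrict_strand_coloring]). Conversely a coloring outside the disk and
    zone colors with matching values at the ends of the strands glue to a
    coloring of the whole diagram ([glue_coloring]). It remains to see that, in
    both pictures of a move, the colors at the left ends of the strands
    determine all zone colors, and lead to the same colors at the right ends:
    for R1 this is idempotence ([R1_constant]), for R2 invertibility of
    x |-> x |> y ([R2_transfer]), and for R3 self-distributivity
    ([R3_transfer]).

    The strands of a picture are always read from left to right, whichever way
    the component runs. This is harmless: in the resulting equation
    z = x |>^e y for the colors x and z to the left and to the right of the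
    crossing, the exponent e depends on the orientation of the over-strand, but
    not on that of the under-strand ([crossing_rule_place]), and the three
    identities hold for all exponents. *)

Set Implicit Arguments.
Unset Strict Implicit.
Unset Printing Implicit Defensive.

Local Open Scope classical_set_scope.
Local Open Scope ring_scope.

(** * Counting by correspondences *)

(** In the applications [r] says that two colorings correspond under a move;
    partners are constructed separately in either direction, and the condition
    [r] makes them unique. *)
Lemma card_eq_rel (T U : Type) (A : set T) (B : set U) (r : T -> U -> Prop) :
  (forall a, A a -> exists2 b, B b & r a b) ->
  (forall b, B b -> exists2 a, A a & r a b) ->
  (forall a b b', A a -> B b -> B b' -> r a b -> r a b' -> b = b') ->
  (forall a a' b, A a -> A a' -> B b -> r a b -> r a' b -> a = a') ->
  (A #= B)%card.
Proof.
move=> AB BA uB uA; pose f a b := A a /\ B b /\ r a b.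
pose g (a : T) : option U :=
  if pselect (exists b, f a b) is left H then Some (sval (cid H)) else None.
have gP a : A a -> exists2 b, f a b & g a = Some b.
  move=> Aa; rewrite /g; case: pselect => [H|]; first by case: cid => b fb; exists b.
  by case: (AB a Aa) => b Bb rab; case; exists b.
have gi : {in A &, injective g}.
  move=> a a' /set_mem Aa /set_mem Aa'.
  case: (gP a Aa) => b [_ [Bb rb]] ->; case: (gP a' Aa') => b' [_ [_ rb']] -> [bb'].
  by apply: (uA a a' b) => //; rewrite bb'.
apply: (card_eq_trans (B := g @` A)).
  by rewrite card_eq_sym; exact: inj_card_eq.
suff -> : g @` A = Some @` B by apply: inj_card_eq => x y _ _ [].
apply/seteqP; split => [_ [a Aa <-]|_ [b Bb <-]].
  by case: (gP a Aa) => b [_ [Bb _]] ->; exists b.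
case: (BA b Bb) => a Aa rab; exists a => //.
by case: (gP a Aa) => b' [_ [Bb' rab']] ->; congr Some; apply: (uB a).
Qed.

Lemma card_fset_set_eq (T U : choiceType) (A : set T) (B : set U) :
  (A #= B)%card -> #|` fset_set A|%fset = #|` fset_set B|%fset.
Proof.
move=> AB; case: (pselect (finite_set A)) => fA.
  by apply/fcard_eq => //; rewrite -(eq_finite_set AB).
have fB : ~ finite_set B by rewrite -(eq_finite_set AB).
by rewrite /fset_set; case: pselect => [/fA[]|_]; case: pselect => [/fB[]|_].
Qed.

(** * The two operations of a quandle *)

Section SignedOperation.
Variables (T : Type) (X : quandle T).

Lemma qdiv_ex x y : exists z, X z y = x.
Proof. by case: (qop_bij X y) => g _ gK; exists (g x); rewrite gK. Qed.

Definition qdiv x y : T := sval (cid (qdiv_ex x y)).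

Definition sop (e : bool) x y : T := if e then X x y else qdiv x y.

Lemma qop_inj y : injective (fun x => X x y).
Proof. by case: (qop_bij X y) => g gK _; exact: can_inj gK. Qed.

Lemma qdivK x y : X (qdiv x y) y = x.
Proof. by rewrite /qdiv; case: cid. Qed.

Lemma sopNK e x y : sop (~~ e) (sop e x y) y = x.
Proof.
case: e => /=; last exact: qdivK.
by apply: (@qop_inj y); rewrite qdivK.
Qed.

Lemma sopKN e x y : sop e (sop (~~ e) x y) y = x.
Proof. by rewrite -{1}(negbK e) sopNK. Qed.

Lemma sop_inj e y : injective (fun x => sop e x y).
Proof. by move=> a b /= ab; rewrite -(sopNK e a y) ab sopNK. Qed.

Lemma sop_idem e x : sop e x x = x.
Proof.
by case: e; [|apply: (@qop_inj x); rewrite /= qdivK]; rewrite /= qop_idem.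
Qed.

(** Right translation by z is an automorphism of X, so it commutes with both
    operations, and so does its inverse. *)
Lemma sop_dist e d x y z :
  sop d (sop e x y) z = sop e (sop d x z) (sop d y z).
Proof.
have D e' a b c : X (sop e' a b) c = sop e' (X a c) (X b c).
  case: e' => /=; first exact: qop_dist.
  by apply: (@qop_inj (X b c)); rewrite -qop_dist !qdivK.
case: d => /=; first exact: D.
by apply: (@qop_inj z); rewrite D /= !qdivK.
Qed.

End SignedOperation.

(** * Colorings of a diagram *)

Section Colorings.
Variables (R : realType) (n : nat).
Implicit Types (D : diagram R n) (p q o u : ppoint R n).

Definition visible D p : Prop := in_dom p /\ ~ under_pt D p.

Definition free_itv D (i : option 'I_n) (s t : R) : Prop :=
  forall r, s <= r <= t -> ~ under_pt D (i, r).

(** The value [d] outside the visible points is a normalisation: it makes a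
    coloring determined by its values on the arcs. The crossing condition
    compares two points around the undercrossing [u] with no further
    undercrossing in between, which avoids naming arcs. *)
Record coloring D (T : Type) (X : quandle T) (d : T) (c : ppoint R n -> T) :
    Prop := Coloring {
  col_out : forall p, ~ visible D p -> c p = d;
  col_shift : forall p m, (p.1 = None -> m = 0) -> c (shift_pt p m) = c p;
  col_itv : forall i s t, s <= t -> in_dom (i, s) -> in_dom (i, t) ->
    free_itv D i s t -> c (i, s) = c (i, t);
  col_cross : forall o u a b, crossing D o u -> a < u.2 < b ->
    in_dom (u.1, a) -> in_dom (u.1, b) ->
    (forall r, a <= r <= b -> r != u.2 -> ~ under_pt D (u.1, r)) ->
    c (u.1, b) = sop X (positive_crossing D o u) (c (u.1, a)) (c o) }.

Lemma shift_pt0 p : shift_pt p 0 = p.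
Proof. by case: p => i t; rewrite /shift_pt addr0. Qed.

Lemma shift_ptD p m m' : shift_pt (shift_pt p m) m' = shift_pt p (m + m').
Proof. by rewrite /shift_pt /= intrD addrA. Qed.

Lemma same_point_refl p : same_point p p.
Proof. by exists 0; rewrite shift_pt0. Qed.

Lemma same_point_shift p m : (p.1 = None -> m = 0) -> same_point p (shift_pt p m).
Proof. by move=> hm; exists m. Qed.

Lemma same_point_sym p q : same_point p q -> same_point q p.
Proof.
move=> [m [hm ->]]; exists (- m); rewrite shift_ptD subrr shift_pt0; split=> //=.
by move=> /hm ->; rewrite oppr0.
Qed.

Lemma same_point_trans p q r : same_point p q -> same_point q r -> same_point p r.
Proof.
move=> [m [hm ->]] [m' [hm' ->]]; exists (m + m'); rewrite shift_ptD; split=> //.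
by move=> h; rewrite hm ?hm' ?addr0.
Qed.

Lemma curve_int_periodic D i (m : int) t :
  curve D (Some i) (t + m%:~R) = curve D (Some i) t.
Proof.
have N (k : nat) s : curve D (Some i) (s + k%:R) = curve D (Some i) s.
  by elim: k s => [|k IH] s; rewrite ?addr0// -natr1 addrA curve_periodic IH.
case: m => k; first exact: N.
by rewrite NegzE mulrNz -(N k.+1 (t - _)) subrK.
Qed.

Lemma ev_same D p q : same_point p q -> ev D p = ev D q.
Proof.
move=> [m [hm ->]]; case: p hm => -[i|] t /= hm; rewrite /ev /=.
  by rewrite curve_int_periodic.
by rewrite hm// addr0.
Qed.

Lemma in_dom_same p q : same_point p q -> in_dom p -> in_dom q.
Proof.
by move=> [m [hm ->]]; rewrite /in_dom /= => h h1; rewrite hm// addr0; exact: h.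
Qed.

Lemma double_point_sym D p q :
  double_point (curve D) p q -> double_point (curve D) q p.
Proof. by move=> [? ? h e]; split => // /same_point_sym. Qed.

Lemma double_point_same D p p' q : same_point p p' ->
  double_point (curve D) p q -> double_point (curve D) p' q.
Proof.
move=> pp' [dp dq h e]; split => //; first exact: in_dom_same pp' dp.
  by move=> /(same_point_trans pp').
by rewrite -e; apply/esym/ev_same.
Qed.

Lemma under_same D p q : same_point p q -> under_pt D p -> under_pt D q.
Proof.
move=> pq up; have [r dr] := under_double up.
apply/(under_one (double_point_same pq dr)) => ur.
by move/(under_one dr): up.
Qed.

Lemma visible_same D p q : same_point p q -> visible D p -> visible D q.
Proof.
move=> pq [dp up]; split; first exact: in_dom_same pq dp.
by move=> /(under_same (same_point_sym pq)).
Qed.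

Lemma crossing_visible D o u : crossing D o u -> visible D o.
Proof.
by move=> [H uu]; split; [case: H|move=> /(under_one H)].
Qed.

End Colorings.

(** * Colorings from homomorphisms *)

Lemma min_max_itvE (R : realType) (a b x : R) :
  (Num.min a b <= x <= Num.max a b) = (a <= x <= b) || (b <= x <= a).
Proof.
case: (leP a b) => ab; rewrite ?(min_l ab) ?(max_r ab) ?(min_r (ltW ab)) ?(max_l (ltW ab)).
  by apply/idP/idP => [->//|/orP[//|]]; lra.
by apply/idP/idP => [->|/orP[|//]]; rewrite ?orbT//; lra.
Qed.

Section Homomorphisms.
Variables (R : realType) (n : nat) (D : diagram R n) (T : Type) (X : quandle T).
Implicit Types (p q o u : ppoint R n).

Lemma in_dom_itv (i : option 'I_n) (a b r : R) : in_dom (i, a) -> in_dom (i, b) ->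
  a <= r <= b -> in_dom (i, r).
Proof. by move=> da db ar /= h; have := da h; have := db h => /=; lra. Qed.

Lemma joined_refl p : ~ under_pt D p -> joined D p p.
Proof.
case: p => i t np; split=> //; exists 0; rewrite shift_pt0 minxx maxxx; split=> // r /=.
by move=> /le_anti <-.
Qed.

Lemma joined_itv (i : option 'I_n) (s t : R) : s <= t -> free_itv D i s t ->
  joined D (i, s) (i, t).
Proof.
move=> st f; split=> //; exists 0; rewrite shift_pt0 /=; split=> // r.
by rewrite min_l// max_r//; exact: f.
Qed.

Lemma joined_shift p m : ~ under_pt D p -> (p.1 = None -> m = 0) ->
  joined D (shift_pt p m) p.
Proof.
case: p => i t np hm; split=> //; exists m; split => // r /= hr np'.
suff e : r = t + m%:~R.
  by apply: np; apply: under_same np'; rewrite e; apply/same_point_sym/same_point_shift.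
by move: hr; rewrite minxx maxxx => /le_anti ->.
Qed.

Lemma joined_sym p q : joined D p q -> joined D q p.
Proof.
case: p q => i s [j t] /= [/= <-] [m [hm f]]; split=> //; exists (- m).
split=> [/= /hm ->|r /= hr ur]; first by rewrite oppr0.
apply: (f (r + m%:~R)); last first.
  by apply: under_same ur; exact: (@same_point_shift R n (i, r)).
by move: hr => /=; rewrite rmorphN /= !min_max_itvE; lra.
Qed.

Lemma joined_trans p q r : joined D p q -> joined D q r -> joined D p r.
Proof.
case: p q r => i s [j t] [k v] /= [/= <-] [m [hm f]] [/= <-] [m' [hm' f']].
split=> //; exists (m + m').
split=> [/= h|x /= hx ux]; first by rewrite hm ?hm' ?addr0.
have f2 (y : R) : Num.min t (v + m'%:~R) <= y - m%:~R <= Num.max t (v + m'%:~R) ->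
    ~ under_pt D (i, y).
  move=> hy uy; apply: (f' (y - m%:~R) hy); apply: under_same uy.
  exists (- m); split=> [/= h|]; first by rewrite hm ?oppr0.
  by rewrite /shift_pt /= rmorphN.
case: (boolP (Num.min s (t + m%:~R) <= x <= Num.max s (t + m%:~R))) => [/f//|].
case: (boolP (Num.min t (v + m'%:~R) <= x - m%:~R <= Num.max t (v + m'%:~R))) => [/f2//|].
by move: hx; rewrite intrD !min_max_itvE; lra.
Qed.

Lemma arc_through_eq p q : joined D p q -> arc_through D p = arc_through D q.
Proof.
move=> pq; apply/seteqP; split=> r [dr jr]; split=> //.
  exact: joined_trans (joined_sym pq) jr.
exact: joined_trans pq jr.
Qed.

Definition vis_arc p (vp : visible D p) : diag_arc D :=
  exist _ (arc_through D p) (ex_intro _ p (And3 vp.1 vp.2 erefl)).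

Lemma diag_arc_inj (A B : diag_arc D) : sval A = sval B -> A = B.
Proof. by case: A B => [A hA] [B hB] /= AB; exact: eq_exist. Qed.

Lemma coloring_joined d c p q : coloring D X d c -> in_dom p -> in_dom q ->
  joined D p q -> c p = c q.
Proof.
case: p q => i s [j t] hc ds dt [/= ij [m [hm f]]]; move: ij dt f => <- dt f.
rewrite -(col_shift hc (p := (i, t)) hm) /shift_pt /=.
have dt' : in_dom (i, t + m%:~R).
  exact: (in_dom_same (@same_point_shift R n (i, t) m hm) dt).
case: (leP s (t + m%:~R)) => h.
  apply: (col_itv hc) => // r hr; apply: f.
  by rewrite /= min_l// max_r.
apply/esym/(col_itv hc) => //; first exact: ltW.
by move=> r hr; apply: f; rewrite /= min_r ?max_l// ltW.
Qed.

Local Notation Q := (fundamental_carrier D).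
Local Notation rel := (@crossing_relation R n D).
Local Notation gen A := (qclass rel (QGen A)).

Definition hom_color (d : T) (f : Q -> T) p : T :=
  if pselect (visible D p) is left vp then f (gen (vis_arc vp)) else d.

Lemma hom_colorE d f p (vp : visible D p) (A : diag_arc D) :
  sval A = arc_through D p -> hom_color d f p = f (gen A).
Proof.
move=> hA; rewrite /hom_color; case: pselect => // vp'.
by congr (f (gen _)); apply: diag_arc_inj; rewrite hA.
Qed.

Lemma hom_color_joined d f p q : visible D p -> visible D q -> joined D p q ->
  hom_color d f p = hom_color d f q.
Proof.
move=> vp vq jpq; rewrite (@hom_colorE d f p vp (vis_arc vp))//.
by rewrite (@hom_colorE d f q vq (vis_arc vp))//; exact: arc_through_eq.
Qed.

Definition quandle_hom (f : Q -> T) : Prop :=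
  forall a b, f (fundamental_quandle D a b) = X (f a) (f b).

Lemma hom_sop f (e : bool) s t : quandle_hom f ->
  f (qclass rel (if e then QOp s t else QOpV s t)) =
  sop X e (f (qclass rel s)) (f (qclass rel t)).
Proof.
move=> hf.
have fop s' t' : f (qclass rel (QOp s' t')) = X (f (qclass rel s')) (f (qclass rel t')).
  by rewrite -hf /= presented_opE.
case: e; first exact: fop.
apply: (@qop_inj _ X (f (qclass rel t))); rewrite /= qdivK -fop; congr f.
exact/qclassP/qcong_opVK.
Qed.

Lemma hom_color_coloring d f : quandle_hom f -> coloring D X d (hom_color d f).
Proof.
move=> hf; split.
- by move=> p np; rewrite /hom_color; case: pselect.
- move=> p m hm; have pp := same_point_shift hm.
  case: (pselect (visible D p)) => vp.
    apply: hom_color_joined => //; first exact: visible_same pp vp.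
    by apply: joined_shift => //; case: vp.
  rewrite /hom_color; case: pselect => [v|_]; last by case: pselect.
  by case: vp; exact: visible_same (same_point_sym pp) v.
- move=> i s t st ds dt f0; apply: hom_color_joined; last exact: joined_itv.
  + by split=> //; apply: f0; rewrite lexx.
  + by split=> //; apply: f0; rewrite st lexx.
move=> o u a b cou /andP[au ub] da db fr.
have va : visible D (u.1, a).
  by split=> //; apply: fr; [lra|rewrite lt_eqF].
have vb : visible D (u.1, b).
  by split=> //; apply: fr; [lra|rewrite gt_eqF].
have vo := crossing_visible cou.
rewrite (hom_colorE d f va (A := vis_arc va))//.
rewrite (hom_colorE d f vb (A := vis_arc vb))//.
rewrite (hom_colorE d f vo (A := vis_arc vo))//.
rewrite -hom_sop//; congr f; apply/qclassP/qcong_rel.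
constructor => //.
- by split; [case: vo|apply: joined_refl; case: vo].
- rewrite /incoming_arc; near=> t.
  have ht : a <= t < u.2.
    apply/andP; split; last by near: t; exact: nbhs_left_lt.
    by near: t; apply: nbhs_left_ge.
  split; first by apply: (in_dom_itv da db); lra.
  apply: joined_itv; first lra.
  by move=> r hr; apply: fr; [lra|rewrite lt_eqF//; lra].
- rewrite /outgoing_arc; near=> t.
  have ht : u.2 < t <= b.
    apply/andP; split; first by near: t; exact: nbhs_right_gt.
    by near: t; apply: nbhs_right_le.
  split; first by apply: (in_dom_itv da db); lra.
  apply/joined_sym/joined_itv; first lra.
  by move=> r hr; apply: fr; [lra|rewrite gt_eqF//; lra].
Unshelve. all: by end_near. Qed.

End Homomorphisms.

(** * Homomorphisms from colorings *)

Section Evaluation.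
Variables (G T : Type) (X : quandle T) (g : G -> T).

Fixpoint qeval (t : qterm G) : T :=
  match t with
  | QGen x => g x
  | QOp s t => X (qeval s) (qeval t)
  | QOpV s t => qdiv X (qeval s) (qeval t)
  end.

Lemma qeval_qcong (rel : qterm G -> qterm G -> Prop) s t :
  (forall s t, rel s t -> qeval s = qeval t) ->
  qcong rel s t -> qeval s = qeval t.
Proof.
move=> hrel; elim=> {s t} //=.
- by move=> s t u _ -> _ ->.
- by move=> s s' t t' _ -> _ ->.
- by move=> s s' t t' _ -> _ ->.
- by move=> t; exact: qop_idem.
- by move=> s t; exact: (sopNK X true).
- by move=> s t; exact: qdivK.
- by move=> s t u; exact: qop_dist.
Qed.

End Evaluation.

Section LeftRight.
Variable R : realType.

Lemma near_left_itv (u : R) (P : R -> Prop) :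
  (\forall t \near u^'-, P t) -> exists2 a, a < u & forall t, a <= t < u -> P t.
Proof.
move=> /nbhs_ballP[e /= e0 h]; exists (u - e / 2); first by lra.
move=> t ht; apply: h; last by rewrite /=; lra.
by rewrite /ball /= ger0_norm; lra.
Qed.

Lemma near_right_itv (u : R) (P : R -> Prop) :
  (\forall t \near u^'+, P t) -> exists2 b, u < b & forall t, u < t <= b -> P t.
Proof.
move=> /nbhs_ballP[e /= e0 h]; exists (u + e / 2); first by lra.
move=> t ht; apply: h; last by rewrite /=; lra.
by rewrite /ball /= ltr0_norm; lra.
Qed.

End LeftRight.

Section ColoringsAreHomomorphisms.
Variables (R : realType) (n : nat) (D : diagram R n) (T : Type) (X : quandle T).
Implicit Types (p q o u : ppoint R n).

Local Notation Q := (fundamental_carrier D).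
Local Notation rel := (@crossing_relation R n D).
Local Notation gen A := (qclass rel (QGen A)).

Definition arc_pt (A : diag_arc D) : ppoint R n := sval (cid (svalP A)).

Lemma arc_ptP A :
  [/\ in_dom (arc_pt A), ~ under_pt D (arc_pt A) & sval A = arc_through D (arc_pt A)].
Proof. by rewrite /arc_pt; case: cid. Qed.

Lemma coloring_arc d c A p : coloring D X d c -> sval A p -> c (arc_pt A) = c p.
Proof.
move=> hc; have [dA _ ->] := arc_ptP A => -[dp jp].
exact: coloring_joined hc dA dp jp.
Qed.

(** The interval witnessing that a point lies on an arc contains that point, so
    arcs contain no undercrossings. *)
Lemma arc_visible (A : diag_arc D) p : sval A p -> visible D p.
Proof.
case: p => i t; have [_ _ ->] := arc_ptP A => -[dp jp]; split=> //.
have [_ [m [hm f]]] := joined_sym jp; apply: f.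
by rewrite /= ge_min le_max lexx.
Qed.

(** The incoming and outgoing arcs of an undercrossing contain a one-sided
    neighbourhood of it, which provides the two points that the crossing
    condition of a coloring speaks about. *)
Lemma qeval_crossing d c s t : coloring D X d c -> crossing_relation s t ->
  qeval X (fun A => c (arc_pt A)) s = qeval X (fun A => c (arc_pt A)) t.
Proof.
move=> hc; case=> o u x y z cou oy hin hout.
have [a au ha] := near_left_itv hin; have [b ub hb] := near_right_itv hout.
have xa : sval x (u.1, a) by apply: ha; lra.
have zb : sval z (u.1, b) by apply: hb; lra.
have -> : qeval X (fun A => c (arc_pt A)) (QGen z) =
          sop X (positive_crossing D o u) (c (u.1, a)) (c o).
  rewrite /= (coloring_arc hc zb); apply: (col_cross hc) => //.
  - by rewrite au ub.
  - by case: (arc_visible xa).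
  - by case: (arc_visible zb).
  move=> r hr ru; have [h|h] : a <= r < u.2 \/ u.2 < r <= b.
    by move: ru; rewrite neq_lt => /orP[h|h]; [left|right]; lra.
  - by case: (arc_visible (ha r h)).
  - by case: (arc_visible (hb r h)).
by case: ifP => _; rewrite /= (coloring_arc hc xa) (coloring_arc hc oy).
Qed.

Definition color_hom (c : ppoint R n -> T) (C : Q) : T :=
  qeval X (fun A => c (arc_pt A)) (qrepr C).

Lemma color_homE d c t : coloring D X d c ->
  color_hom c (qclass rel t) = qeval X (fun A => c (arc_pt A)) t.
Proof.
move=> hc; apply: (qeval_qcong (rel := rel)); last by apply/qclassP; rewrite qreprK.
by move=> s t'; exact: (qeval_crossing hc).
Qed.

Lemma color_hom_hom d c : coloring D X d c -> quandle_hom X (color_hom c).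
Proof.
move=> hc C E; rewrite -(qreprK C) -(qreprK E) /= presented_opE.
by rewrite !(color_homE _ hc).
Qed.

Lemma hom_determined (f f' : Q -> T) : quandle_hom X f -> quandle_hom X f' ->
  (forall A, f (gen A) = f' (gen A)) -> f = f'.
Proof.
move=> hf hf' ff'; apply/funext => C; rewrite -(qreprK C).
elim: (qrepr C) => // s IHs t IHt.
  by rewrite (hom_sop true s t hf) (hom_sop true s t hf') IHs IHt.
by rewrite (hom_sop false s t hf) (hom_sop false s t hf') IHs IHt.
Qed.

Lemma visible_leg : visible D (leg_pt R n).
Proof. by split; [exact: in_dom_leg|exact: not_under_leg]. Qed.

Lemma visible_head : visible D (head_pt R n).
Proof. by split; [exact: in_dom_head|exact: not_under_head]. Qed.

Definition pointed_colorings (i j : T) : set (ppoint R n -> T) :=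
  [set c | [/\ coloring D X i c, c (leg_pt R n) = i & c (head_pt R n) = j]].

(** The two constructions [hom_color] and [color_hom] are mutually inverse
    because the generators of the presentation are exactly the arcs. *)
Lemma homs_colorings_card i j :
  ([set f : Q -> T | pointed_hom (fundamental_quandle D) (leg_generator D)
      (head_generator D) X i j f] #= pointed_colorings i j)%card.
Proof.
apply: (@card_eq_rel _ _ _ _ (fun f c => c = hom_color i f)).
- move=> f [hf [fl fh]]; exists (hom_color i f) => //; split.
  + exact: hom_color_coloring.
  + by rewrite (hom_colorE i f visible_leg (A := leg_arc D)).
  + by rewrite (hom_colorE i f visible_head (A := head_arc D)).
- move=> c [hc cl ch]; exists (color_hom c).
    split; first exact: (color_hom_hom hc).
    split; rewrite [LHS](color_homE _ hc) /=.
      rewrite (@coloring_arc i c (leg_arc D) (leg_pt R n))//.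
      by split; [exact: in_dom_leg|apply: joined_refl; exact: not_under_leg].
    rewrite (@coloring_arc i c (head_arc D) (head_pt R n))//.
    by split; [exact: in_dom_head|apply: joined_refl; exact: not_under_head].
  apply/funext => p; case: (pselect (visible D p)) => vp.
    rewrite (hom_colorE i _ vp (A := vis_arc vp))// (color_homE _ hc) /=.
    apply/esym/(coloring_arc hc); split; first by case: vp.
    by apply: joined_refl; case: vp.
  by rewrite (col_out hc vp) /hom_color; case: pselect.
- by move=> f b b' _ _ _ -> ->.
- move=> f f' c [hf _] [hf' _] _ -> ff'; apply: hom_determined => // A.
  have [dA uA eA] := arc_ptP A; have vA : visible D (arc_pt A) by [].
  have := congr1 (fun c => c (arc_pt A)) ff'.
  by rewrite !(hom_colorE i _ vA (A := A)).
Qed.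

End ColoringsAreHomomorphisms.

Lemma counting_invariant_eq (R : realType) (n k : nat) (X : quandle 'I_k)
    (D D' : diagram R n) i j :
  (pointed_colorings D X i j #= pointed_colorings D' X i j)%card ->
  counting_invariant X i j D = counting_invariant X i j D'.
Proof.
move=> DD'; apply: card_fset_set_eq.
apply: card_eq_trans (homs_colorings_card D X i j) _.
apply: card_eq_trans DD' _.
by rewrite card_eq_sym; exact: homs_colorings_card.
Qed.

(** * Identifications of diagrams *)

Section Isomorphisms.
Variables (R : realType) (n : nat).
Implicit Types (D : diagram R n) (p q o u : ppoint R n).

Definition param_map (s : option 'I_n -> option 'I_n) (rho : option 'I_n -> R -> R) p
  : ppoint R n := (s p.1, rho p.1 p.2).

(** [D'] is [D] seen through the change of parameters [param_map s rho]. Beside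
    the bijection on parameter points, only three features of the curves enter
    the notion of coloring: which points coincide, which ones are
    undercrossings, and the signs of the crossings. *)
Record diagram_iso D D' (s : option 'I_n -> option 'I_n)
    (rho : option 'I_n -> R -> R) : Prop := DiagramIso {
  iso_inj : injective s;
  iso_None : forall i, s i = None <-> i = None;
  iso_dom : forall p, in_dom p -> in_dom (param_map s rho p);
  iso_surj : forall q, in_dom q -> exists2 p, in_dom p & param_map s rho p = q;
  iso_mono : forall i a b, in_dom (i, a) -> in_dom (i, b) -> a < b -> rho i a < rho i b;
  iso_shift : forall i a (m : int), (i = None -> m = 0) ->
    rho i (a + m%:~R) = rho i a + m%:~R;
  iso_leg : param_map s rho (leg_pt R n) = leg_pt R n;
  iso_head : param_map s rho (head_pt R n) = head_pt R n;
  iso_under : forall p, in_dom p -> (under_pt D' p <-> under_pt D (param_map s rho p));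
  iso_ev : forall p q, in_dom p -> in_dom q ->
    (ev D' p = ev D' q <-> ev D (param_map s rho p) = ev D (param_map s rho q));
  iso_pos : forall o u, crossing D' o u -> positive_crossing D' o u =
    positive_crossing D (param_map s rho o) (param_map s rho u) }.

Section Pullback.
Variables (D D' : diagram R n) (s : option 'I_n -> option 'I_n)
  (rho : option 'I_n -> R -> R).
Hypothesis H : diagram_iso D D' s rho.
Local Notation tr := (param_map s rho).

Lemma iso_mono_le i a b : in_dom (i, a) -> in_dom (i, b) ->
  (rho i a <= rho i b) = (a <= b).
Proof.
move=> da db; case: (ltgtP a b) => [ab|ba|->]; last by rewrite lexx.
  by rewrite ltW// (iso_mono H).
by rewrite leNgt (iso_mono H).
Qed.

Lemma iso_mono_lt i a b : in_dom (i, a) -> in_dom (i, b) ->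
  (rho i a < rho i b) = (a < b).
Proof. by move=> da db; rewrite !ltNge iso_mono_le. Qed.

Lemma param_map_inj p q : in_dom p -> in_dom q -> tr p = tr q -> p = q.
Proof.
case: p q => i a [j b] dp dq [/(iso_inj H) ij]; move: ij dq => <- {j} dq ab.
by congr pair; apply/le_anti; rewrite -(iso_mono_le dp dq) -(iso_mono_le dq dp) ab lexx.
Qed.

Lemma param_map_shift p m : (p.1 = None -> m = 0) ->
  tr (shift_pt p m) = shift_pt (tr p) m.
Proof. by case: p => i a hm; rewrite /param_map /shift_pt /= (iso_shift H). Qed.

Lemma param_map_same p q : in_dom p -> in_dom q ->
  (same_point p q <-> same_point (tr p) (tr q)).
Proof.
move=> dp dq; split=> [[m [hm ->]]|[m [hm e]]].
  by rewrite param_map_shift//; apply: same_point_shift => /= /(iso_None H).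
have hm' : p.1 = None -> m = 0 by move=> h; apply: hm; apply/(iso_None H).
exists m; split=> //; apply: param_map_inj => //; last by rewrite param_map_shift.
exact: in_dom_same (same_point_shift hm') dp.
Qed.

Lemma iso_double p q : in_dom p -> in_dom q ->
  (double_point (curve D') p q <-> double_point (curve D) (tr p) (tr q)).
Proof.
move=> dp dq; have sp := param_map_same dp dq; have ep := iso_ev H dp dq.
split=> -[_ _ np e]; split=> //; try exact: (iso_dom H).
- by move/sp.
- exact/ep.
- by move/sp.
- exact/ep.
Qed.

Lemma iso_crossing o u : in_dom o -> in_dom u ->
  (crossing D' o u <-> crossing D (tr o) (tr u)).
Proof.
by move=> dO du; split=> -[/(iso_double dO du) ? /(iso_under H du) ?].
Qed.

Lemma iso_visible p : in_dom p -> (visible D' p <-> visible D (tr p)).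
Proof.
move=> dp; split=> -[_ np]; split=> //; first exact: (iso_dom H).
  by move/(iso_under H dp).
by move/(iso_under H dp).
Qed.

(** An increasing bijection maps intervals onto intervals, so arcs go to arcs. *)
Lemma param_map_itv i a b r : in_dom (i, a) -> in_dom (i, b) ->
  rho i a <= r <= rho i b -> exists2 x, a <= x <= b & tr (i, x) = (s i, r).
Proof.
move=> da db hr.
have dr : in_dom (s i, r).
  exact: in_dom_itv (iso_dom H da) (iso_dom H db) hr.
have [[j x] dx e] := iso_surj H dr; case: (e) => /(iso_inj H) ij ex.
move: ij dx e ex => -> dx e ex; exists x => //.
by rewrite -(iso_mono_le da dx) -(iso_mono_le dx db) ex.
Qed.

Variables (T : Type) (X : quandle T) (d : T).

Definition pullback (c : ppoint R n -> T) p : T :=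
  if pselect (in_dom p) then c (tr p) else d.

Lemma pullbackE c p : in_dom p -> pullback c p = c (tr p).
Proof. by rewrite /pullback; case: pselect. Qed.

Lemma pullback_out c p : ~ in_dom p -> pullback c p = d.
Proof. by rewrite /pullback; case: pselect. Qed.

Lemma pullback_coloring c : coloring D X d c -> coloring D' X d (pullback c).
Proof.
move=> hc; split.
- move=> p np; case: (pselect (in_dom p)) => dp; last by rewrite pullback_out.
  rewrite pullbackE//.
  by apply: (col_out hc) => /(iso_visible dp).
- move=> p m hm; have pp := same_point_shift hm.
  case: (pselect (in_dom p)) => dp.
    rewrite !pullbackE//; last exact: in_dom_same pp dp.
    rewrite param_map_shift//; apply: (col_shift hc) => /= h.
    by apply: hm; apply/(iso_None H).
  by rewrite !pullback_out// => /(in_dom_same (same_point_sym pp)).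
- move=> i a b ab da db f; rewrite !pullbackE//.
  have da' := iso_dom H da; have db' := iso_dom H db.
  apply: (col_itv hc) => //; first by rewrite /= (iso_mono_le da db).
  move=> r hr; have [x hx <-] := param_map_itv da db hr.
  by move=> /(iso_under H (in_dom_itv da db hx)); exact: f.
move=> o u a b cou /andP[au ub] da db fr.
have [dO du _ _] := cou.1.
rewrite (iso_pos H cou) !pullbackE//.
have du' : in_dom (u.1, u.2) by case: (u) du.
have da' := iso_dom H da; have db' := iso_dom H db.
apply: (@col_cross _ _ _ _ _ _ _ hc (tr o) (tr u) (rho u.1 a) (rho u.1 b)) => //.
- exact/iso_crossing.
- by rewrite /= !iso_mono_lt// au.
move=> r hr ru; have [x hx e] := param_map_itv da db hr; rewrite -e.
move=> /(iso_under H (in_dom_itv da db hx)); apply: fr => //.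
by apply: contraNneq ru => xu; case: e => <-; rewrite xu.
Qed.

End Pullback.

(** With the inverse at hand, pulling back along it inverts the pullback of
    colorings. *)
Lemma diagram_iso_inv D D' s rho : diagram_iso D D' s rho ->
  exists s' rho', [/\ diagram_iso D' D s' rho',
    forall p, in_dom p -> param_map s' rho' (param_map s rho p) = p &
    forall q, in_dom q -> param_map s rho (param_map s' rho' q) = q].
Proof.
move=> H.
pose inv q : ppoint R n :=
  if pselect (in_dom q) is left dq then sval (cid2 (iso_surj H dq)) else q.
have invP q : in_dom q -> in_dom (inv q) /\ param_map s rho (inv q) = q.
  by move=> dq; rewrite /inv; case: pselect => // dq'; case: cid2.
have invK p : in_dom p -> inv (param_map s rho p) = p.
  move=> dp; have [d1 e1] := invP _ (iso_dom H dp).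
  exact: (param_map_inj H).
have dmid (i : option 'I_n) : in_dom (i, 0 : R) by move=> _ /=; rewrite lexx ler01.
pose s' i := (inv (i, 0)).1; pose rho' i t := (inv (i, t)).2.
have s'K i : s (s' i) = i by have [_ []] := invP _ (dmid i).
have invE q : in_dom q -> param_map s' rho' q = inv q.
  case: q => i t dq; rewrite /param_map /rho' /=.
  have [_ [e _]] := invP _ dq; case: (inv (i, t)) e => j x /= e; congr pair.
  by apply: (iso_inj H); rewrite s'K e.
have s'inj : injective s' by move=> i j ij; rewrite -(s'K i) ij s'K.
have s'None i : s' i = None <-> i = None.
  by rewrite -(iso_None H) s'K.
have dinv q : in_dom q -> in_dom (inv q) by move=> /invP[].
have tr'K q : in_dom q -> param_map s rho (param_map s' rho' q) = q.
  by move=> dq; rewrite invE//; case: (invP q dq).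
have trK' p : in_dom p -> param_map s' rho' (param_map s rho p) = p.
  by move=> dp; rewrite invE ?invK//; exact: (iso_dom H).
have dom' p : in_dom p -> in_dom (param_map s' rho' p).
  by move=> dp; rewrite invE//; exact: dinv.
exists s', rho'; split=> //; split=> //.
- by move=> q dq; exists (param_map s rho q); [exact: (iso_dom H)|rewrite trK'].
- move=> i a b da db ab; have /= da' := dom' _ da; have /= db' := dom' _ db.
  rewrite -(iso_mono_lt H da' db').
  by case: (tr'K _ da) => _ ->; case: (tr'K _ db) => _ ->.
- move=> i a m hm; case: i hm => [i|] hm; last by rewrite hm// !addr0.
  have dall t : in_dom (Some i, t : R) by [].
  have hm' : (s' (Some i), rho' (Some i) a).1 = None -> m = 0.
    by move=> /= /s'None.
  have := param_map_inj H (dom' _ (dall (a + m%:~R)))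
    (in_dom_same (same_point_shift hm') (dom' _ (dall a))).
  rewrite (param_map_shift H hm').
  move=> h.
  have /h[] // : param_map s rho (param_map s' rho' (Some i, a + m%:~R)) =
     shift_pt (param_map s rho (s' (Some i), rho' (Some i) a)) m.
  by rewrite !(tr'K _ (dall _)).
- by rewrite -[X in param_map _ _ X](iso_leg H) trK'//; exact: in_dom_leg.
- by rewrite -[X in param_map _ _ X](iso_head H) trK'//; exact: in_dom_head.
- by move=> p dp; rewrite (iso_under H (dom' _ dp)) tr'K.
- by move=> p q dp dq; rewrite (iso_ev H (dom' _ dp) (dom' _ dq)) !tr'K.
- move=> o u cou; have [dO du _ _] := cou.1.
  rewrite (iso_pos H) ?tr'K//; apply/(iso_crossing H); rewrite ?tr'K//; exact: dom'.
Qed.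

Lemma iso_colorings_card D D' s rho (T : Type) (X : quandle T) i j :
  diagram_iso D D' s rho ->
  (pointed_colorings D X i j #= pointed_colorings D' X i j)%card.
Proof.
move=> H; have [s' [rho' [H' K K']]] := diagram_iso_inv H.
have dl := @in_dom_leg R n; have dh := @in_dom_head R n.
apply: (@card_eq_rel _ _ _ _
  (fun c c' => forall p, in_dom p -> c' p = c (param_map s rho p))).
- move=> c [hc cl ch]; exists (pullback s rho i c); last by move=> p dp; rewrite pullbackE.
  split; first exact: (pullback_coloring H).
    by rewrite pullbackE// (iso_leg H).
  by rewrite pullbackE// (iso_head H).
- move=> c [hc cl ch]; exists (pullback s' rho' i c).
    split; first exact: (pullback_coloring H').
      by rewrite pullbackE// (iso_leg H').
    by rewrite pullbackE// (iso_head H').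
  by move=> p dp; rewrite pullbackE ?K//; exact: (iso_dom H).
- move=> c b b' _ [hb _ _] [hb' _ _] cb cb'; apply/funext => p.
  case: (pselect (in_dom p)) => dp; first by rewrite cb// cb'.
  by rewrite (col_out hb) ?(col_out hb')// => -[].
- move=> c c' b [hc _ _] [hc' _ _] _ cb cb'; apply/funext => p.
  case: (pselect (in_dom p)) => dp.
    by rewrite -(K' p dp) -cb -?cb'//; exact: (iso_dom H').
  by rewrite (col_out hc) ?(col_out hc')// => -[].
Qed.

End Isomorphisms.

(** * Determinants of triples of vectors *)

Section Determinant.
Variable R : realType.
Implicit Types (u v w x : 'rV[R]_3).

Lemma sum3E (F : 'I_3 -> R) : \sum_(i < 3) F i = F 0 + F 1 + F 2.
Proof.
rewrite !big_ord_recl big_ord0 addr0 addrA; congr (_ + F _ + F _); exact: val_inj.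
Qed.

Lemma det3E u v w : det3 u v w =
  u 0 0 * (v 0 1 * w 0 2 - v 0 2 * w 0 1) -
  u 0 1 * (v 0 0 * w 0 2 - v 0 2 * w 0 0) +
  u 0 2 * (v 0 0 * w 0 1 - v 0 1 * w 0 0).
Proof.
rewrite /det3 (expand_det_row _ 0) sum3E /cofactor.
rewrite !(expand_det_row _ 0) !big_ord_recl !big_ord0 /cofactor !det_mx11 !mxE.
have e00 : lift 0 (0 : 'I_2) = 1 :> 'I_3 by exact: val_inj.
have e01 : lift 0 (1 : 'I_2) = 2 :> 'I_3 by exact: val_inj.
have e10 : lift 1 (0 : 'I_2) = 0 :> 'I_3 by exact: val_inj.
have e11 : lift 1 (1 : 'I_2) = 2 :> 'I_3 by exact: val_inj.
have e20 : lift 2 (0 : 'I_2) = 0 :> 'I_3 by exact: val_inj.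
have e21 : lift 2 (1 : 'I_2) = 1 :> 'I_3 by exact: val_inj.
have f0 : lift (0 : 'I_2) (0 : 'I_1) = 1 :> 'I_2 by exact: val_inj.
have f1 : lift (1 : 'I_2) (0 : 'I_1) = 0 :> 'I_2 by exact: val_inj.
rewrite ?(e00, e01, e10, e11, e20, e21, f0, f1) /=.
rewrite ?(e00, e01, e10, e11, e20, e21, f0, f1) /=.
rewrite ?expr0 ?expr1 ?addn0 ?add0n /=.
rewrite (_ : (((1 %% 3) + (1 %% 3)) %% 3 = 2)%N)//.
by ring.
Qed.

Definition dot u v : R := \sum_(i < 3) u 0 i * v 0 i.

Lemma dotE u v : dot u v = u 0 0 * v 0 0 + u 0 1 * v 0 1 + u 0 2 * v 0 2.
Proof. exact: sum3E. Qed.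

Lemma dot_comb (a b : R) u v x :
  dot x (a *: u + b *: v) = a * dot x u + b * dot x v.
Proof. by rewrite !dotE !mxE; ring. Qed.

Lemma det3Zl (a : R) u v w : det3 (a *: u) v w = a * det3 u v w.
Proof. by rewrite !det3E !mxE; ring. Qed.

Lemma det3Zm (a : R) u v w : det3 u (a *: v) w = a * det3 u v w.
Proof. by rewrite !det3E !mxE; ring. Qed.

Lemma det3_comb (a b c d : R) u v w :
  det3 (a *: u + b *: v) (c *: u + d *: v) w = (a * d - b * c) * det3 u v w.
Proof. by rewrite !det3E !mxE; ring. Qed.

(** A linear relation between two tangent vectors and the normal has coefficient
    0 on the normal, as the scalar product with the normal shows. *)
Lemma det3_tangent_neq0 u v x : dot x x = 1 -> dot x u = 0 -> dot x v = 0 ->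
  (forall a b : R, a *: u + b *: v = 0 -> a = 0 /\ b = 0) -> det3 u v x != 0.
Proof.
move=> xx xu xv free; apply/negP => /det0P[z z0 ez].
have ez' : z 0 0 *: u + z 0 1 *: v + z 0 2 *: x = 0.
  by apply/rowP => j; move/rowP: ez => /(_ j); rewrite !mxE sum3E !mxE.
have z2 : z 0 2 = 0.
  have : dot x (z 0 0 *: u + z 0 1 *: v + z 0 2 *: x) = 0.
    by rewrite ez' dotE !mxE; ring.
  have -> : dot x (z 0 0 *: u + z 0 1 *: v + z 0 2 *: x) =
     z 0 0 * dot x u + z 0 1 * dot x v + z 0 2 * dot x x.
    by rewrite !dotE !mxE; ring.
  by rewrite xx xu xv !mulr0 !add0r mulr1.
move: ez'; rewrite z2 scale0r addr0 => /free[z_0 z_1].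
move/eqP: z0; apply; apply/rowP => j; rewrite mxE.
by case: j => -[|[|[|//]]] hj; [rewrite -[RHS]z_0|rewrite -[RHS]z_1|rewrite -[RHS]z2];
  congr (z _ _); exact: val_inj.
Qed.

Lemma det3_free u v x : det3 u v x != 0 ->
  forall a b : R, a *: u + b *: v = 0 -> a = 0 /\ b = 0.
Proof.
move=> d0 a b e.
have ha := det3_comb a b 0 1 u v x; have hb := det3_comb 1 0 a b u v x.
have z y : det3 0 y x = 0 by rewrite det3E !mxE; ring.
have z' y : det3 y 0 x = 0 by rewrite det3E !mxE; ring.
move: ha hb; rewrite e z z' mulr1 mulr0 subr0 mul1r mul0r subr0.
by move=> /esym/eqP + /esym/eqP; rewrite !mulf_eq0 (negbTE d0) !orbF => /eqP -> /eqP ->.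
Qed.

End Determinant.

(** * Velocities *)

Section Calculus.
Variable R : realType.

Lemma is_derive_comp (V W : normedModType R) (f : V -> W) (g : R -> V) (t : R) (dg : V) :
  differentiable f (g t) -> is_derive t 1 g dg ->
  is_derive t 1 (f \o g) ('d f (g t) dg).
Proof.
move=> df [/derivable1_diffP hg <-].
have hfg : differentiable (f \o g) t by exact: differentiable_comp.
split; first exact/derivable1_diffP.
by rewrite !deriveE// diff_comp.
Qed.

Lemma is_derive_reparam (W : normedModType R) (f : R -> W) (g : R -> R) (t a : R) (df : W) :
  is_derive (g t) 1 f df -> is_derive t 1 g a -> is_derive t 1 (f \o g) (a *: df).
Proof.
move=> [hf <-] hg; have hf' : differentiable f (g t) by exact/derivable1_diffP.
have := is_derive_comp hf' hg.
by rewrite diff1E//= derive1E.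
Qed.

(** The derivative of the constant [dot g g] is [2 * dot g v]. *)
Lemma derive_tangent (g : R -> 'rV[R]_3) (t : R) (v : 'rV[R]_3) :
  is_derive t 1 g v -> (\forall s \near t, sphere (g s)) -> dot (g t) v = 0.
Proof.
move=> [hg hv] sg.
have hi i : is_derive t 1 (fun s => g s 0 i) (v 0 i).
  split; first by move/derivable_mxP: hg; exact.
  by rewrite -hv derive_mx// mxE.
have : is_derive t 1 (fun s => \sum_(i < 3) g s 0 i ^+ 2) (2 * dot (g t) v).
  under eq_fun do rewrite sum3E.
  apply: is_derive_eq.
  by rewrite dotE /GRing.scale /=; ring.
have h1 : is_derive t 1 (fun s => \sum_(i < 3) g s 0 i ^+ 2) 0.
  have h0 := is_derive_cst (1 : R) t (1 : R).
  apply: near_eq_is_derive h0.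
  by apply: filterS sg => s /= <-.
by move=> [_ h2]; move: h1 => [_]; rewrite h2 => /eqP; rewrite mulf_eq0 pnatr_eq0 => /eqP.
Unshelve. all: by end_near. Qed.

End Calculus.

Section Velocity.
Variables (R : realType) (n : nat).
Implicit Types (D : diagram R n) (p q o u : ppoint R n).

(** At the endpoints the velocity depends on values of the curve that do not
    belong to the diagram; crossings avoid the endpoints ([double_inner]), so
    velocities are only compared at inner points. *)
Definition inner p : Prop := p.1 = None -> 0 < p.2 < 1.

Lemma inner_in_dom p : inner p -> in_dom p.
Proof. by move=> h /h /andP[/ltW -> /ltW ->]. Qed.

Lemma double_inner D p q : double_point (curve D) p q -> inner p.
Proof.
case: p => i t H hi; have [/(_ hi) /= /andP[t0 t1] _ _ _] := H.
rewrite /= in hi; rewrite hi in H.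
rewrite !lt_neqAle t0 t1 !andbT; apply/andP; split.
  by apply/eqP => e; rewrite -e in H; exact: curve_leg H.
by apply/eqP => e; rewrite e in H; exact: curve_head H.
Qed.

Lemma near_inner p : inner p -> \forall t \near p.2, inner (p.1, t).
Proof.
case: p => -[i|] t h; first by near=> s.
have /andP[t0 t1] := h erefl; near=> s => _ /=.
by apply/andP; split; near: s; [exact: lt_nbhsr|exact: lt_nbhsl].
Unshelve. all: by end_near. Qed.

Lemma is_derive_ev D i t : in_dom (i, t) -> is_derive t 1 (curve D i) (velocity D (i, t)).
Proof.
by move=> dp; split; [exact: (curve_derivable dp)|rewrite /velocity derive1E]. Qed.

Lemma velocity_near D p (g : R -> 'rV[R]_3) v : is_derive p.2 1 g v ->
  (\forall t \near p.2, ev D (p.1, t) = g t) -> velocity D p = v.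
Proof.
move=> hg e; rewrite /velocity derive1E.
have [_ <-] := hg; apply: near_eq_derive; exact: e.
Qed.

Lemma dot_velocity D p : inner p -> dot (ev D p) (velocity D p) = 0.
Proof.
case: p => i t h; apply: derive_tangent.
  by apply: is_derive_ev; exact: inner_in_dom h.
have := near_inner h; apply: filterS => s /inner_in_dom; exact: (@curve_sphere R n D).
Qed.

Lemma crossing_transverse D o u : crossing D o u ->
  det3 (velocity D o) (velocity D u) (ev D o) != 0.
Proof. by move=> [/curve_transverse]. Qed.

End Velocity.

(** * Isotopies *)

Section Isotopy.
Variables (R : realType) (n : nat).
Implicit Types (D : diagram R n) (p q o u : ppoint R n).

Lemma within_slice (V : topologicalType) (F : R * 'rV[R]_3 -> V) x :
  sphere x ->
  {within [set z : R * 'rV[R]_3 | 0 <= z.1 <= 1 /\ sphere z.2], continuous F} ->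
  {within `[0, 1], continuous (fun t => F (t, x))}.
Proof.
move=> sx /subspace_continuousP cF; apply/subspace_continuousP => t /= ht.
rewrite in_itv /= in ht.
apply: cvg_trans (cF (t, x) (conj ht sx)).
move=> B /= hB; rewrite /nbhs /= in hB *.
have c1 : (fun s : R => s) @ t --> t by [].
have c2 : (fun _ : R => x) @ t --> x by exact: cvg_cst.
have pc : (fun s : R => (s, x)) @ t --> (t, x) by exact: cvg_pair c1 c2.
have hn : nbhs t (fun s : R => 0 <= s <= 1 /\ sphere x -> B (F (s, x))) := pc _ hB.
suff : nbhs t (fun s : R => `[0, 1]%classic s -> B (F (s, x))) by [].
by apply: filterS hn => s h /=; rewrite in_itv /= => hs; apply: h.
Qed.

Lemma within_det3 (a b c : R -> 'rV[R]_3) :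
  {within `[0, 1], continuous a} -> {within `[0, 1], continuous b} ->
  {within `[0, 1], continuous c} ->
  {within `[0, 1], continuous (fun t => det3 (a t) (b t) (c t))}.
Proof.
have coord (a' : R -> 'rV[R]_3) i (t : R) :
   {within `[0, 1], continuous a'} -> `[0, 1]%classic t ->
   (fun s => a' s 0 i) @ within `[0, 1] (nbhs t) --> a' t 0 i.
  move=> /subspace_continuousP ca ht.
  exact: cvg_comp (ca t ht) (@coord_continuous R 1 3 0 i (a' t)).
move=> ca cb cc; apply/subspace_continuousP => t ht.
have := coord _ _ _ ca ht; have := coord _ _ _ cb ht; have := coord _ _ _ cc ht.
move=> {}cc {}cb {}ca.
suff : (fun s => det3 (a s) (b s) (c s)) @ within `[0, 1] (nbhs t) -->
  det3 (a t) (b t) (c t) by [].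
rewrite det3E (_ : (fun s => det3 (a s) (b s) (c s)) = (fun s => 
  a s 0 0 * (b s 0 1 * c s 0 2 - b s 0 2 * c s 0 1) -
  a s 0 1 * (b s 0 0 * c s 0 2 - b s 0 2 * c s 0 0) +
  a s 0 2 * (b s 0 0 * c s 0 1 - b s 0 1 * c s 0 0))); last first.
  by apply/funext => s; rewrite det3E.
by apply: cvgD; [apply: cvgB|]; apply: cvgM => //; apply: cvgB; apply: cvgM.
Qed.

Lemma nonvanishing_sign (f : R -> R) : {within `[0, 1], continuous f} ->
  (forall t, 0 <= t <= 1 -> f t != 0) -> (0 < f 0) = (0 < f 1).
Proof.
move=> cf f0; apply/idP/idP => h; rewrite ltNge; apply/negP => h'.
  have [|c hc e] := IVT (v := 0) ler01 cf; last first.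
    by move: (f0 c); rewrite e eqxx => /(_ hc).
  by rewrite ge_min le_max h' (ltW h) orbT.
have [|c hc e] := IVT (v := 0) ler01 cf; last first.
  by move: (f0 c); rewrite e eqxx => /(_ hc).
by rewrite ge_min le_max h' (ltW h) orbT.
Qed.

Lemma near_sphere D p : inner p -> \forall s \near p.2, sphere (curve D p.1 s).
Proof.
move=> /near_inner; apply: filterS => s /inner_in_dom.
exact: (@curve_sphere R n D).
Qed.

(** The velocities of the strands are used as tangent vectors, which gives for
    free curves on the sphere through the crossing: the differential of [H 0]
    fixes such a velocity because [H 0] fixes the curve, and the differential of
    [H t] sends it to a tangent vector because the image of the curve lies on
    the sphere. *)
Lemma isotopy_sign D o u (H : R -> 'rV[R]_3 -> 'rV[R]_3) :
  sphere_isotopy H -> crossing D o u ->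
  (0 < det3 (velocity D o) (velocity D u) (ev D o)) =
  (0 < det3 ('d (H 1) (ev D o) (velocity D o))
            ('d (H 1) (ev D o) (velocity D u)) (H 1 (ev D o))).
Proof.
move=> [H0 Hbij Hcont Hdiff Hdcont] cou; set x := ev D o.
have [dou _] := cou; have [dO du _ xu] := dou; have ou := xu : ev D o = ev D u.
have io := double_inner dou; have iu := double_inner (double_point_sym dou).
have sx : sphere x by exact: (@curve_sphere R n D).
have comp t p : 0 <= t <= 1 -> inner p -> ev D p = x ->
    is_derive p.2 1 (H t \o curve D p.1) ('d (H t) x (velocity D p)).
  case: p => i s ht hp ex; rewrite -ex; apply: is_derive_comp.
    by rewrite -[curve D _ _]/(ev D (i, s)) ex; case: (Hdiff t x ht sx).
  by apply: is_derive_ev; exact: inner_in_dom.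
have tang t p : 0 <= t <= 1 -> inner p -> ev D p = x ->
    dot (H t x) ('d (H t) x (velocity D p)) = 0.
  move=> ht hp ex; rewrite -[X in H t X]ex; apply: (derive_tangent (comp t p ht hp ex)).
  apply: filterS (near_sphere D hp) => s hs.
  by case: (Hbij t ht) => + _ _; apply.
have start p : inner p -> ev D p = x -> 'd (H 0) x (velocity D p) = velocity D p.
  move=> hp ex; apply/esym/(velocity_near (comp 0 p _ hp ex)); first by rewrite lexx ler01.
  by apply: filterS (near_sphere D hp) => s hs; rewrite /= H0.
pose f t := det3 ('d (H t) x (velocity D o)) ('d (H t) x (velocity D u)) (H t x).
have -> : det3 (velocity D o) (velocity D u) x = f 0.
  by rewrite /f !start// H0.
apply: (@nonvanishing_sign f).
  apply: within_det3.
  - exact: (within_slice sx (Hdcont _)).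
  - exact: (within_slice sx (Hdcont _)).
  - exact: (within_slice sx Hcont).
move=> t ht; apply: det3_tangent_neq0; rewrite ?tang//.
  have : sphere (H t x) by case: (Hbij t ht) => + _ _; apply.
  by move=> <-; apply: eq_bigr => i _; rewrite expr2.
move=> a b; rewrite -!linearZ -linearD => e.
apply: (det3_free (crossing_transverse cou)).
case: (Hdiff t x ht sx) => _; apply => //.
rewrite -[LHS]/(dot x _).
by rewrite dot_comb {2}/x ou !dot_velocity// !mulr0 addr0.
Qed.

Lemma isotopic_iso D D' : isotopic D D' -> diagram_iso D D' id (fun=> id).
Proof.
move=> [H [iso hev hu]]; have [_ Hbij _ Hdiff _] := iso.
have h1 : 0 <= (1 : R) <= 1 by rewrite ler01 lexx.
have pm p : param_map id (fun=> id) p = p by case: p.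
split=> //; try by move=> *; rewrite ?pm.
- by move=> q dq; exists q; rewrite ?pm.
- move=> p q dp dq; rewrite !pm !hev//; split=> [|->//].
  case: (Hbij 1 h1) => _ + _; apply; exact/mem_set/(@curve_sphere R n D).
move=> o u; rewrite !pm => cou'.
have [dou' _] := cou'; have [dO du _ xu] := dou'; have ou := xu : ev D' o = ev D' u.
have evE p q : in_dom p -> in_dom q -> ev D' p = ev D' q -> ev D p = ev D q.
  move=> dp dq; rewrite !hev//.
  case: (Hbij 1 h1) => _ + _; apply; exact/mem_set/(@curve_sphere R n D).
have cou : crossing D o u.
  case: cou' => -[d1 d2 ns e] /hu uu; split=> //; split=> //.
  exact: evE.
have io := double_inner dou'; have iu := double_inner (double_point_sym dou').
have vel p : inner p -> velocity D' p = 'd (H 1) (ev D p) (velocity D p).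
  move=> hp; have sp : sphere (ev D p) by apply: (@curve_sphere R n D); exact: inner_in_dom.
  apply: (@velocity_near R n D' p (H 1 \o curve D p.1)).
    apply: is_derive_comp; first by case: (Hdiff 1 _ h1 sp).
    by case: (p) hp => i t hp; apply: is_derive_ev; exact: inner_in_dom.
  by apply: filterS (near_inner hp) => s /inner_in_dom /hev ->.
have ouD : ev D o = ev D u by exact: evE dO du ou.
rewrite /positive_crossing (isotopy_sign iso cou) (vel o io) (vel u iu) (hev o dO).
by rewrite -ouD.
Qed.

End Isotopy.

(** * Reparametrisations *)

Section Reparametrisation.
Variables (R : realType) (n : nat).
Implicit Types (D : diagram R n) (p q o u : ppoint R n).

Lemma increasing_homeo (f : R -> R) (a b : R) :
  (forall t, a <= t <= b -> derivable f t 1 /\ 0 < derive1 f t) ->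
  (forall s t, a <= s -> s < t -> t <= b -> f s < f t) /\
  (a <= b -> forall y, f a <= y <= f b -> exists2 t, a <= t <= b & f t = y).
Proof.
move=> df.
have cf : {within `[a, b], continuous f}.
  by apply: derivable_within_continuous => t; rewrite in_itv /= => /df[].
split=> [s t as_ st tb|ab y hy].
  apply: (gtr0_derive1_lt_cc _ _ cf) => //; rewrite ?in_itv /=; try lra.
    by move=> x; rewrite in_itv /= => hx; case: (df x _) => //; lra.
  by move=> x; rewrite in_itv /= => hx; case: (df x _) => //; lra.
have fab : f a <= f b by lra.
have [|c hc e] := IVT (v := y) ab cf; first by rewrite (min_l fab) (max_r fab).
by exists c => //; rewrite in_itv /= in hc.
Qed.

(** A positive derivative makes the change of parameter increasing, and the
    intermediate value theorem makes it onto. On a circle it commutes with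
    integer translations and is therefore unbounded in both directions. The
    velocities are multiplied by positive numbers, so signs are preserved. *)
Lemma reparametrised_iso D D' : reparametrised D D' ->
  exists s rho, diagram_iso D D' s rho.
Proof.
move=> [sg [rho [[r0 r1] rS hrho hev hu]]]; pose s := omap sg : option 'I_n -> option 'I_n.
rewrite -/s in hev hu.
exists s, rho.
have shift i (m : int) a : rho (Some i) (a + m%:~R) = rho (Some i) a + m%:~R.
  have N (k : nat) b : rho (Some i) (b + k%:R) = rho (Some i) b + k%:R.
    by elim: k b => [|k IH] b; rewrite ?addr0// -natr1 !addrA rS IH.
  case: m => k; first exact: N.
  have := N k.+1 (a - k.+1%:R); rewrite subrK => ->.
  by rewrite NegzE mulrNz addrK.
have homeo i a b : in_dom (i, a) -> in_dom (i, b) ->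
    forall t, a <= t <= b -> derivable (rho i) t 1 /\ 0 < derive1 (rho i) t.
  by move=> da db t ht; case: (hrho (i, t) (in_dom_itv da db ht)).
have mono i a b : in_dom (i, a) -> in_dom (i, b) -> a < b -> rho i a < rho i b.
  move=> da db ab.
  by have [h _] := increasing_homeo (homeo i a b da db); apply: h.
have ivt i a b y : in_dom (i, a) -> in_dom (i, b) -> a <= b ->
    rho i a <= y <= rho i b -> exists2 t, a <= t <= b & rho i t = y.
  by move=> da db ab; have [_ h] := increasing_homeo (homeo i a b da db); apply: h.
have dom p : in_dom p -> in_dom (param_map s rho p).
  case: p => -[i|] t dp // _ /=; have /= /andP[t0 t1] := dp erefl.
  have le a b : in_dom (None : option 'I_n, a) -> in_dom (None : option 'I_n, b) ->
      a <= b -> rho None a <= rho None b.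
    move=> da db; rewrite le_eqVlt => /orP[/eqP ->//|ab]; exact/ltW/mono.
  have dl := @in_dom_leg R n; have dh := @in_dom_head R n.
  by apply/andP; split; [rewrite -[leLHS]r0|rewrite -[leRHS]r1]; apply: le.
have sinj : injective s by move=> [i|] [j|] //= [/perm_inj ->].
have pe p : in_dom p -> ev D' p = ev D (param_map s rho p) by move/hev.
split=> //.
- by case.
- move=> [[i|] y] dq.
    (* [rho] increases by exactly [N] on an interval of length [N]. *)
    pose N := (Num.truncn `|y - rho (Some ((sg^-1)%g i)) 0|).+1.
    have hN : `|y - rho (Some ((sg^-1)%g i)) 0| < N%:R by exact: truncnS_gt.
    have dall t : in_dom (Some ((sg^-1)%g i), t : R) by [].
    have e1 := shift ((sg^-1)%g i) (- N%:Z) 0; have e2 := shift ((sg^-1)%g i) N%:Z 0.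
    rewrite !add0r ?mulrNz in e1 e2.
    have [|  |t _ e] := ivt _ (- N%:R) N%:R y (dall _) (dall _).
    + by have := ler0n R N; lra.
    + by rewrite e1 e2; move: hN; rewrite ltr_norml; lra.
    by exists (Some ((sg^-1)%g i), t); rewrite // /param_map /= permKV e.
  have [||t ht e] := ivt None 0 1 y (@in_dom_leg R n) (@in_dom_head R n) _ _ => //.
  + by rewrite r0 r1; exact: dq.
  by exists (None, t); rewrite // /param_map /= e.
- by move=> [i|] a m hm; rewrite ?shift// hm// !addr0.
- by rewrite /param_map /= r0.
- by rewrite /param_map /= r1.
- by move=> p q dp dq; rewrite !pe.
move=> o u cou'; have [dou' _] := cou'; have [dO du _ _] := dou'.
have io := double_inner dou'; have iu := double_inner (double_point_sym dou').
have vel p : inner p -> exists2 a, 0 < a &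
    velocity D' p = a *: velocity D (param_map s rho p).
  move=> hp; have dp := inner_in_dom hp; have [h1 _ h2] := hrho p dp.
  exists (derive1 (rho p.1) p.2) => //.
  apply: (@velocity_near R n D' p (curve D (s p.1) \o rho p.1)).
    apply: is_derive_reparam; last by rewrite derive1E; exact: derivableP.
    exact: is_derive_ev (dom p dp).
  by apply: filterS (near_inner hp) => t /inner_in_dom /hev ->.
have [a a0 ea] := vel o io; have [b b0 eb] := vel u iu.
by rewrite /positive_crossing ea eb det3Zl det3Zm pe// !pmulr_rgt0.
Qed.

End Reparametrisation.

(** * Constancy and crossing conditions *)

Section LocallyConstant.
Variable R : realType.

Lemma near_dist (r : R) (P : R -> Prop) :
  (\forall t \near r, P t) <-> exists2 e, 0 < e & forall t, `|t - r| < e -> P t.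
Proof.
split=> [/nbhs_ballP[e /= e0 h]|[e e0 h]].
  by exists e => // t ht; apply: h; rewrite /ball /= distrC.
apply/nbhs_ballP; exists e => // t; rewrite /ball /= => ht.
by apply: h; rewrite distrC.
Qed.

(** Otherwise the indicator function of the level set of [f a] would be
    continuous and take the values 0 and 1 only, against the intermediate value
    theorem. *)
Lemma locally_constant_itv (T : Type) (f : R -> T) (a b : R) : a <= b ->
  (forall r, a <= r <= b -> \forall t \near r, a <= t <= b -> f t = f r) ->
  f a = f b.
Proof.
move=> ab lc; pose g t : R := (`[< f t = f a >])%:R.
have cg : {within `[a, b], continuous g}.
  apply/subspace_continuousP => r; rewrite /= in_itv /= => hr.
  apply: cvg_near_cst; have := lc r hr; apply: filterS => t h ht.
  suff : g t = g r by [].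
  by rewrite /g h//; move: ht; rewrite /= in_itv.
apply: contrapT => fab.
have ga : g a = 1 by rewrite /g asboolT.
have gb : g b = 0 by rewrite /g asboolF// => /esym.
have [|c _ e] := IVT (v := 2^-1) ab cg.
  by rewrite ga gb min_r ?ler01// max_l ?ler01//; lra.
by move: e; rewrite /g; case: asbool => /= e; lra.
Qed.

End LocallyConstant.

Section CrossingRule.
Variables (R : realType) (n : nat) (D : diagram R n) (T : Type) (X : quandle T).
Implicit Types (p q o u : ppoint R n) (c : ppoint R n -> T).

Definition between (a b x : R) : bool := (a <= x <= b) || (b <= x <= a).

Definition interval_constant c : Prop :=
  forall i a b, a <= b -> in_dom (i, a) -> in_dom (i, b) -> free_itv D i a b ->
    c (i, a) = c (i, b).

Lemma constant_between c i a b : interval_constant c ->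
  in_dom (i, a) -> in_dom (i, b) ->
  (forall x, between a b x -> ~ under_pt D (i, x)) -> c (i, a) = c (i, b).
Proof.
move=> hc da db f; case: (leP a b) => h.
  by apply: hc => // x hx; apply: f; rewrite /between hx.
apply/esym/hc => //; first exact: ltW.
by move=> x hx; apply: f; rewrite /between hx orbT.
Qed.

Lemma velocity_same p q : same_point p q -> velocity D p = velocity D q.
Proof.
move=> [m [hm ->]]; case: p hm => -[i|] t /= hm; last first.
  by rewrite hm// /shift_pt /= addr0.
pose g := curve D (Some i) \o (fun s => s - m%:~R).
have hg : is_derive (t + m%:~R) 1 g (velocity D (Some i, t)).
  rewrite -[velocity _ _]scale1r; apply: is_derive_reparam => /=.
    by rewrite addrK; exact: is_derive_ev.
  by apply: is_derive_eq; rewrite subr0.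
have e : \forall s \near t + m%:~R, ev D (Some i, s) = g s.
  near=> s; rewrite /ev /g /= -[s in LHS](subrK m%:~R).
  exact: curve_int_periodic.
by rewrite (@velocity_near R n D (shift_pt (Some i, t) m) _ _ hg e).
Unshelve. all: by end_near. Qed.

Lemma positive_same o o' u u' : same_point o o' -> same_point u u' ->
  positive_crossing D o u = positive_crossing D o' u'.
Proof.
move=> oo uu.
by rewrite /positive_crossing (velocity_same oo) (velocity_same uu) (ev_same D oo).
Qed.

Definition crossing_rule c o u : Prop :=
  forall a b, a < u.2 < b -> in_dom (u.1, a) -> in_dom (u.1, b) ->
    (forall r, a <= r <= b -> r != u.2 -> ~ under_pt D (u.1, r)) ->
    c (u.1, b) = sop X (positive_crossing D o u) (c (u.1, a)) (c o).

(** All pairs of points around the undercrossing that qualify for the crossing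
    condition lie on the same two arcs, so one such pair suffices. *)
Lemma crossing_rule_local c o u a0 b0 : interval_constant c ->
  a0 < u.2 < b0 -> in_dom (u.1, a0) -> in_dom (u.1, b0) ->
  (forall r, a0 <= r <= b0 -> r != u.2 -> ~ under_pt D (u.1, r)) ->
  c (u.1, b0) = sop X (positive_crossing D o u) (c (u.1, a0)) (c o) ->
  crossing_rule c o u.
Proof.
move=> hc hu0 da0 db0 f0 e0 a b hu da db f.
have -> : c (u.1, b) = c (u.1, b0).
  apply: constant_between => // x /orP hx.
  have hxu : x != u.2 by apply/eqP => e; rewrite e in hx; lra.
  case: hx => hx; [apply: f0|apply: f] => //; lra.
have -> : c (u.1, a) = c (u.1, a0).
  apply: constant_between => // x /orP hx.
  have hxu : x != u.2 by apply/eqP => e; rewrite e in hx; lra.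
  case: hx => hx; [apply: f|apply: f0] => //; lra.
exact: e0.
Qed.

Lemma crossing_rule_same c o o' u u' :
  (forall p m, (p.1 = None -> m = 0) -> c (shift_pt p m) = c p) ->
  same_point o o' -> same_point u u' -> crossing_rule c o u -> crossing_rule c o' u'.
Proof.
move=> cs oo uu h a b; rewrite -(positive_same oo uu).
have -> : c o' = c o by case: oo => m [hm ->]; exact: cs.
case: uu => m [hm ->]; rewrite /shift_pt /= => hab da db f.
have sh (x : R) : same_point (u.1, x) (u.1, x - m%:~R).
  exists (- m); split=> [/= /hm ->|]; first by rewrite oppr0.
  by rewrite /shift_pt /= rmorphN.
have cE (x : R) : c (u.1, x) = c (u.1, x - m%:~R).
  rewrite -[x in LHS](subrK m%:~R); exact: (cs (u.1, x - m%:~R)).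
rewrite (cE a) (cE b); apply: h; first lra.
- exact: in_dom_same (sh a) da.
- exact: in_dom_same (sh b) db.
move=> r hr ru ur; apply: (f (r + m%:~R)); first lra.
  by apply: contraNneq ru => /addIr ->.
apply: under_same ur.
by exists m; split.
Qed.

End CrossingRule.

(** * Zones of a strand *)

Section Zones.
Variable R : realType.

Definition cut_at (k : nat) : R := [:: - (1 / 2); 0; 1 / 2]`_k.

(** A parameter [cut_at k] belongs to the zone [k] on its left. At a cut where
    the strand passes under, no color is read off; elsewhere the colors on both
    sides agree, so the convention has no effect on colorings. *)
Definition zone (u : R) : nat := ((- (1 / 2) < u)%R + (0 < u)%R + (1 / 2 < u)%R)%N.

(** Zones 0 and 3 are represented by the ends of the strand, so that their colors
    are the values to be matched with the outside of the disk. *)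
Definition zone_pt (k : nat) : R := [:: - 1; - (1 / 4); 1 / 4; 1]`_k.

Lemma zone_cases u : [\/ u <= - (1 / 2) /\ zone u = 0%N, - (1 / 2) < u <= 0 /\ zone u = 1%N,
  0 < u <= 1 / 2 /\ zone u = 2%N | 1 / 2 < u /\ zone u = 3%N].
Proof.
rewrite /zone; have [h1|h1] := ltP (- (1 / 2)) u; last first.
  by constructor 1; rewrite !ltNge [u <= 0](le_trans h1) ?[u <= 1 / 2](le_trans h1)//; lra.
have [h2|h2] := ltP 0 u; last first.
  by constructor 2; rewrite ltNge [u <= 1 / 2](le_trans h2)//; lra.
by have [h3|h3] := ltP (1 / 2) u; [constructor 4|constructor 3].
Qed.

Lemma zone_cut_at (k : 'I_3) : zone (cut_at k) = k.
Proof.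
move: (zone_cases (cut_at k)); rewrite /cut_at.
by case: k => -[|[|[|//]]] hk /= [] [h ->] //; exfalso; lra.
Qed.

Lemma zone_zone_pt (k : 'I_4) : zone (zone_pt k) = k.
Proof.
move: (zone_cases (zone_pt k)); rewrite /zone_pt.
by case: k => -[|[|[|[|//]]]] hk /= [] [h ->] //; exfalso; lra.
Qed.

Lemma zone_lt4 u : (zone u < 4)%N.
Proof. by case: (zone_cases u) => -[_ ->]. Qed.

Lemma cut_at_sym (k : 'I_3) : -1 < cut_at k < 1.
Proof. by rewrite /cut_at; case: k => -[|[|[|//]]] hk /=; lra. Qed.

Lemma zone_pt_sym k : sym_itv (zone_pt k).
Proof.
rewrite /sym_itv /zone_pt /=; case: k => [|[|[|[|k]]]] /=; rewrite ?nth_nil; lra.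
Qed.

Lemma zone_pt_cut (k : 'I_3) : zone_pt k < cut_at k < zone_pt k.+1.
Proof. by rewrite /cut_at /zone_pt; case: k => -[|[|[|//]]] hk /=; lra. Qed.

Lemma between_zone_pt_cut (k l : 'I_3) : between (zone_pt k) (zone_pt k.+1) (cut_at l) -> l = k.
Proof.
rewrite /between /cut_at /zone_pt; case: k => -[|[|[|//]]] hk;
 case: l => -[|[|[|//]]] hl /= h; (try exact: val_inj); exfalso; lra.
Qed.

Lemma between_zone_pt u (k : 'I_3) : sym_itv u ->
  between (zone_pt (zone u)) u (cut_at k) -> cut_at k = u.
Proof.
rewrite /sym_itv /between /zone_pt /cut_at /= => hu.
by case: (zone_cases u) => -[h ->]; case: k => -[|[|[|//]]] hk /= h'; lra.
Qed.

Lemma zone_constant (T : Type) (z : nat -> T) (u v : R) : u <= v ->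
  (forall k : 'I_3, u <= cut_at k <= v -> z k.+1 = z k) -> z (zone u) = z (zone v).
Proof.
move=> uv h.
have h0 : u <= - (1 / 2) <= v -> z 1%N = z 0%N by exact: (h (@Ordinal 3 0 isT)).
have h1 : u <= 0 <= v -> z 2%N = z 1%N by exact: (h (@Ordinal 3 1 isT)).
have h2 : u <= 1 / 2 <= v -> z 3%N = z 2%N by exact: (h (@Ordinal 3 2 isT)).
case: (zone_cases u) => -[hu ->]; case: (zone_cases v) => -[hv ->] //;
  try (exfalso; lra).
all: try (have e0 : z 1%N = z 0%N by apply: h0; lra).
all: try (have e1 : z 2%N = z 1%N by apply: h1; lra).
all: try (have e2 : z 3%N = z 2%N by apply: h2; lra).
all: congruence.
Qed.

End Zones.

(** * Strands in a disk *)

Definition det2 (R : realType) (a b : R * R) : R := a.1 * b.2 - a.2 * b.1.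

(** [cr i k = Some (j, k', s)] records that strand [i] passes at [cut_at k] under
    strand [j], whose parameter is then [cut_at k'], and that [s] is the sign of
    the crossing for strands running from left to right. *)
Definition crossing_table (m : nat) : Type :=
  'I_m -> 'I_3 -> option ('I_m * 'I_3 * bool).

Record has_crossings (R : realType) (m : nat) (pic : picture R m)
    (hgt : 'I_m -> R -> R) (cr : crossing_table m) : Prop := HasCrossings {
  picture_square : forall i u, sym_itv u -> square (pic i u);
  crossing_listed : forall i j u v, sym_itv u -> sym_itv v -> (i, u) <> (j, v) ->
    pic i u = pic j v -> hgt i u < hgt j v ->
    exists (k k' : 'I_3) (s : bool),
      [/\ u = cut_at R k, v = cut_at R k' & cr i k = Some (j, k', s)];
  listed_crossing : forall i k j k' s, cr i k = Some (j, k', s) ->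
    [/\ (i, cut_at R k) <> (j, cut_at R k'), pic i (cut_at R k) = pic j (cut_at R k'),
        hgt i (cut_at R k) < hgt j (cut_at R k') &
        exists di dj, [/\ is_derive (cut_at R k) 1 (pic i) di,
          is_derive (cut_at R k') 1 (pic j) dj & s = (0 < det2 dj di)]] }.

(** [e j] tells whether the component runs forward through strand [j]. The
    equation involves [z j k'], the color of the zone on the left of the
    crossing on the over-strand; nothing changes there at the crossing. *)
Definition strand_coloring (m : nat) (T : Type) (X : quandle T) (e : 'I_m -> bool)
    (cr : crossing_table m) (z : 'I_m -> nat -> T) : Prop :=
  forall i (k : 'I_3), z i k.+1 =
    if cr i k is Some (j, k', s) then sop X (e j == s) (z i k) (z j k') else z i k.

(** The sign of a crossing changes with the direction of either strand. *)
Lemma sign_product (R : realType) (a b d E K : R) :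
  a != 0 -> b != 0 -> d != 0 -> 0 < K -> a * b * d = E * K ->
  (0 < d) = (((0 < b) == (0 < a)) == (0 < E)).
Proof.
move=> a0 b0 d0 K0 e; have -> : (0 < E) = (0 < a * b * d) by rewrite e pmulr_lgt0.
have [ha|ha|ha] := ltgtP 0 a; last by rewrite ha eqxx in a0.
  have [hb|hb|hb] := ltgtP 0 b; last by rewrite hb eqxx in b0.
    by rewrite pmulr_rgt0 ?mulr_gt0//; case: (0 < d).
  rewrite nmulr_rgt0 ?pmulr_rlt0//.
  by have [|//|h] := ltgtP 0 d; last by rewrite h eqxx in d0.
have [hb|hb|hb] := ltgtP 0 b; last by rewrite hb eqxx in b0.
  rewrite nmulr_rgt0 ?nmulr_rlt0//.
  by have [|//|h] := ltgtP 0 d; last by rewrite h eqxx in d0.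
by rewrite pmulr_rgt0 ?nmulr_rgt0//; case: (0 < d).
Qed.

Section Disk.
Variables (R : realType) (n m : nat) (D : diagram R n).
Variables (phi : R * R -> 'rV[R]_3) (pl : placement R n m) (pic : picture R m)
  (hgt : 'I_m -> R -> R) (cr : crossing_table m).
Hypotheses (hphi : disk_chart phi) (hpl : placement_ok pl)
  (hsh : shows D phi pl pic hgt) (hcr : has_crossings pic hgt cr).
Implicit Types (p q o u : ppoint R n).

Definition forward (i : 'I_m) : bool := 0 < strand_rad pl i.

Lemma rad_neq0 i : strand_rad pl i != 0.
Proof.
apply/eqP => r0; have [_ /(_ i i 0 1)] := hpl.
rewrite /sym_itv /place /= r0 !mulr0 => -[].
- lra.
- lra.
- exact: same_point_refl.
by move=> _ /eqP; rewrite eq_sym oner_eq0.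
Qed.

Lemma place_dom i w : sym_itv w -> in_dom (place pl i w).
Proof. by move=> hw /(hpl.1 i w hw) /andP[/ltW -> /ltW ->]. Qed.

Lemma place_on i w : sym_itv w -> on_strands pl (place pl i w).
Proof. by move=> hw; exists i, w; split=> //; exact: same_point_refl. Qed.

Lemma on_same p q : same_point p q -> on_strands pl p -> on_strands pl q.
Proof.
by move=> pq [i [w [hw h]]]; exists i, w; split=> //; exact: same_point_trans h pq.
Qed.

Lemma on_in_dom p : on_strands pl p -> in_dom p.
Proof. by move=> [i [w [hw h]]]; apply: in_dom_same h _; exact: place_dom. Qed.

Lemma on_image p : on_strands pl p -> (phi @` @square R) (ev D p).
Proof.
move=> [i [w [hw h]]]; rewrite -(ev_same D h); have [e _ _] := hsh.
by rewrite e//; exists (pic i w) => //; exact: (picture_square hcr).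
Qed.

Lemma on_ev p q : in_dom q -> on_strands pl p -> ev D p = ev D q -> on_strands pl q.
Proof.
by move=> dq op e; have [_ + _] := hsh; apply => //; rewrite -e; exact: on_image.
Qed.

Lemma double_place i j v w : sym_itv v -> sym_itv w -> (i, v) <> (j, w) ->
  pic i v = pic j w -> double_point (curve D) (place pl i v) (place pl j w).
Proof.
move=> hv hw ne e; split; [exact: place_dom|exact: place_dom| |].
  by move=> /(hpl.2 i j v w hv hw)[ij vw]; apply: ne; rewrite ij vw.
have [h _ _] := hsh.
by rewrite -[LHS]/(ev D (place pl i v)) -[RHS]/(ev D (place pl j w)) !h// e.
Qed.

(** Whatever meets a strand lies over the disk, hence on a strand, and the chart
    is injective: crossings in the disk are visible in the picture. *)
Lemma place_double i v q : sym_itv v -> double_point (curve D) (place pl i v) q ->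
  exists j w, [/\ sym_itv w, same_point (place pl j w) q, (i, v) <> (j, w) &
    pic i v = pic j w].
Proof.
move=> hv [_ dq ns e].
have [j [w [hw h]]] : on_strands pl q by exact: on_ev (place_on i hv) e.
exists j, w; split=> //; first by move=> [ij vw]; apply: ns; rewrite ij vw.
have [hev _ _] := hsh; have [_ phi_inj _ _ _] := hphi.
apply: phi_inj; rewrite ?inE; try exact: (picture_square hcr).
by rewrite -!hev// (ev_same D h).
Qed.

Lemma under_place i v : sym_itv v ->
  (under_pt D (place pl i v) <-> exists (k : 'I_3) x, v = cut_at R k /\ cr i k = Some x).
Proof.
move=> hv; have [_ _ hu] := hsh; split.
  move=> uv; have [q dq] := under_double uv.
  have [j [w [hw h ne e]]] := place_double hv dq.
  have dvw := double_place hv hw ne e.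
  have [k [k' [s [vk _ ek]]]] := crossing_listed hcr hv hw ne e ((hu _ _ _ _ hv hw dvw).1 uv).
  by exists k, (j, k', s).
move=> [k [[[j k'] s] [-> /(listed_crossing hcr)[ne e h _]]]].
have hk : sym_itv (cut_at R k) by have := cut_at_sym R k; rewrite /sym_itv /=; lra.
have hk' : sym_itv (cut_at R k') by have := cut_at_sym R k'; rewrite /sym_itv /=; lra.
by apply/(hu _ _ _ _ hk hk' (double_place hk hk' ne e)).
Qed.

Lemma place_between i v w x : between (place pl i v).2 (place pl i w).2 x ->
  exists2 y, between v w y & (strand_comp pl i, x) = place pl i y.
Proof.
rewrite /place /= => h; have r0 := rad_neq0 i.
exists ((x - strand_mid pl i) / strand_rad pl i); last first.
  by rewrite divfK// addrC subrK.
set y := _ / _; have ex : x = strand_mid pl i + y * strand_rad pl i.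
  by rewrite /y divfK// addrC subrK.
move: h; rewrite ex /between !lerD2l.
have [r1|r1|r1] := ltgtP (strand_rad pl i) 0; last by rewrite r1 eqxx in r0.
  by rewrite !ler_nM2r// orbC ![(_ <= y) && _]andbC.
by rewrite !ler_pM2r.
Qed.

Lemma between_sym (v w y : R) : sym_itv v -> sym_itv w -> between v w y -> sym_itv y.
Proof. by rewrite /sym_itv /between /=; lra. Qed.

Section Colored.
Variables (T : Type) (X : quandle T) (c : ppoint R n -> T).
Hypothesis hc : interval_constant D c.

Lemma strand_constant i v w : sym_itv v -> sym_itv w ->
  (forall k : 'I_3, between v w (cut_at R k) -> cr i k = None) ->
  c (place pl i v) = c (place pl i w).
Proof.
move=> hv hw f; apply: (constant_between hc); try exact: place_dom.
move=> x /(@place_between i)[y hy ->].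
move/(under_place i (between_sym hv hw hy)) => [k [z [yk ek]]].
by move: ek; rewrite f// -yk.
Qed.

Lemma strand_zone i v : sym_itv v -> ~ under_pt D (place pl i v) ->
  c (place pl i v) = c (place pl i (zone_pt R (zone v))).
Proof.
move=> hv nv; apply/esym/strand_constant => //; first exact: zone_pt_sym.
move=> k /(between_zone_pt hv) kv; case e : (cr i k) => [x|//].
by case: nv; apply/under_place => //; exists k, x.
Qed.

(** Chain rule for the two expressions of the strand, through the curve and
    through the chart. *)
Lemma velocity_place i (v : R) (d : R * R) : -1 < v < 1 -> is_derive v 1 (pic i) d ->
  strand_rad pl i *: velocity D (place pl i v) = 'd phi (pic i v) d.
Proof.
move=> hv hd; have sv : sym_itv v by rewrite /sym_itv /=; lra.
have [_ _ dphi _ _] := hphi; have [hev _ _] := hsh.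
have h1 : is_derive v 1 (phi \o pic i) ('d phi (pic i v) d).
  by apply: is_derive_comp => //; apply: dphi; exact: (picture_square hcr).
pose g (w : R) := strand_mid pl i + w * strand_rad pl i.
have hg : is_derive v 1 g (strand_rad pl i).
  rewrite /g; apply: is_derive_eq; rewrite /GRing.scale /=; ring.
have h2 : is_derive v 1 (curve D (strand_comp pl i) \o g)
    (strand_rad pl i *: velocity D (place pl i v)).
  have h3 : is_derive (g v) 1 (curve D (strand_comp pl i)) (velocity D (place pl i v)).
    by apply: is_derive_ev; exact: (place_dom (i := i) sv).
  exact: is_derive_reparam h3 hg.
have [_ <-] := h1; have [_ <-] := h2.
have [v0 v1] := andP hv; apply: near_eq_derive; near=> w.
rewrite -[LHS]/(ev D (place pl i w)) hev// /sym_itv /=.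
have w0 : -1 < w by near: w; exact: lt_nbhsr.
have w1 : w < 1 by near: w; exact: lt_nbhsl.
by rewrite !ltW.
Unshelve. all: by end_near. Qed.

Lemma sym_cut (k : 'I_3) : sym_itv (cut_at R k).
Proof. by have := cut_at_sym R k; rewrite /sym_itv /=; lra. Qed.

(** The determinant of the velocities is that of the slopes in the picture times
    the positive Jacobian of the chart, up to the scaling of both strands. *)
Lemma crossing_place i k j k' s : cr i k = Some (j, k', s) ->
  crossing D (place pl j (cut_at R k')) (place pl i (cut_at R k)) /\
  positive_crossing D (place pl j (cut_at R k')) (place pl i (cut_at R k)) =
    ((forward i == forward j) == s).
Proof.
move=> ek; have [ne e h [di [dj [hi hj ->]]]] := listed_crossing hcr ek.
have dbl := double_place (sym_cut k) (sym_cut k') ne e.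
have hx : crossing D (place pl j (cut_at R k')) (place pl i (cut_at R k)).
  split; first exact: double_point_sym.
  by apply/(under_place i (sym_cut k)); exists k, (j, k', s).
split=> //; rewrite /positive_crossing.
have [_ _ _ _ K0] := hphi; have [hev _ _] := hsh.
have sq := picture_square hcr j (sym_cut k') : square (pic j (cut_at R k')).
apply: (sign_product (rad_neq0 j) (rad_neq0 i) (crossing_transverse hx) (K0 _ sq)).
have -> (a b d : R) : a * b * d = a * (b * d) by rewrite mulrA.
rewrite -det3Zm -det3Zl (velocity_place (cut_at_sym R k') hj).
rewrite (velocity_place (cut_at_sym R k) hi) e hev; last exact: sym_cut.
have dlin (z : R * R) d : 'd phi z d = d.1 *: 'd phi z (1, 0) + d.2 *: 'd phi z (0, 1).
  rewrite -!linearZ -linearD; congr ('d phi z _).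
  by case: d => a b; rewrite [RHS]surjective_pairing /= /GRing.scale /=; congr pair; ring.
by rewrite [in LHS](dlin _ dj) [in LHS](dlin _ di) det3_comb.
Qed.

(** If the component runs backward through strand [i], the incoming arc is the
    one on the right. Solving the relation for the color on the right replaces
    the operation by its inverse, which cancels the effect of the direction of
    strand [i] on the sign. *)
Lemma crossing_rule_place i k j k' s : cr i k = Some (j, k', s) ->
  (crossing_rule D X c (place pl j (cut_at R k')) (place pl i (cut_at R k)) <->
   c (place pl i (zone_pt R k.+1)) = sop X (forward j == s) (c (place pl i (zone_pt R k)))
     (c (place pl j (zone_pt R k')))).
Proof.
move=> ek; have [hx hp] := crossing_place ek.
have -> : c (place pl j (zone_pt R k')) = c (place pl j (cut_at R k')).
  rewrite [RHS]strand_zone ?zone_cut_at//; first exact: sym_cut.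
  by case: (crossing_visible hx).
pose a := place pl i (zone_pt R k); pose b := place pl i (zone_pt R k.+1).
have da : in_dom a by apply: place_dom; exact: zone_pt_sym.
have db : in_dom b by apply: place_dom; exact: zone_pt_sym.
have kk := zone_pt_cut R k.
have free x : between a.2 b.2 x -> x != (place pl i (cut_at R k)).2 ->
    ~ under_pt D (strand_comp pl i, x).
  move=> /(@place_between i)[y hy ey] ne; rewrite ey.
  move/(under_place i (between_sym (zone_pt_sym R _) (zone_pt_sym R _) hy)) => [l [z [yl _]]].
  rewrite yl in hy ey; move/eqP: ne; apply; case: ey => ->.
  by rewrite (between_zone_pt_cut hy).
have [r0|r0|r0] := ltgtP (strand_rad pl i) 0; last first.
- by have := rad_neq0 i; rewrite r0 eqxx.
- have ab : a.2 < (place pl i (cut_at R k)).2 < b.2 by rewrite /= !ltrD2l !ltr_pM2r.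
  have fi : forward i = true by rewrite /forward r0.
  have -> : (forward j == s) = ((forward i == forward j) == s).
    by rewrite fi; case: (forward j).
  rewrite -hp; split.
    by apply => // x hx' ne; apply: free => //; rewrite /between hx'.
  apply: crossing_rule_local => // x hx' ne; apply: free => //.
  by rewrite /between hx'.
have ab : b.2 < (place pl i (cut_at R k)).2 < a.2.
  by rewrite /= !ltrD2l !ltr_nM2r// andbC.
have fi : forward i = false by rewrite /forward ltNge ltW.
have e1 : ~~ (forward j == s) = ((forward i == forward j) == s).
  by rewrite fi; case: (forward j); case: s {ek hp}.
split=> [h|h].
  have -> : c a = sop X (~~ (forward j == s)) (c b) (c (place pl j (cut_at R k'))).
    rewrite e1 -hp; apply: h => // x hx' ne; apply: free => //.
    by rewrite /between hx' orbT.
  by rewrite sopKN.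
apply: (@crossing_rule_local _ _ _ _ _ _ _ _ b.2 a.2) => //.
  move=> x hx' ne; apply: free => //.
  by rewrite /between hx' orbT.
rewrite hp -e1; rewrite -[(_, b.2)]/b -[(_, a.2)]/a h.
by rewrite sopNK.
Qed.

(** Where a strand does not pass under, its color does not change; where it does,
    the equation is the crossing condition. *)
Lemma restrict_strand_coloring :
  (forall o u, crossing D o u -> crossing_rule D X c o u) ->
  strand_coloring X forward cr (fun i k => c (place pl i (zone_pt R k))).
Proof.
move=> hx i k; case ek : (cr i k) => [[[j k'] s]|].
  by apply/(crossing_rule_place ek)/hx; case: (crossing_place ek).
apply/esym/strand_constant; try exact: zone_pt_sym.
by move=> l /between_zone_pt_cut ->.
Qed.

End Colored.
End Disk.

(** * Neighbourhoods of the strands *)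

Section NearStrands.
Variables (R : realType) (n m : nat) (pl : placement R n m).
Hypothesis hpl : placement_ok pl.
Implicit Types (p q o u : ppoint R n).

(** The translate by [k] of the parameter interval of strand [i], of centre [a]
    and half-length [b], contains [t] when [k] lies between [t - a - b] and
    [t - a + b]. The integers outside these bounds for [t = r] are at most [lo]
    or at least [hi], which leaves room to move [t] away from [r]. *)
Lemma strand_near i (r : R) : \forall t \near r, forall k : int,
  `|t - k%:~R - strand_mid pl i| <= `|strand_rad pl i| ->
  `|r - k%:~R - strand_mid pl i| <= `|strand_rad pl i|.
Proof.
set a := strand_mid pl i; set b := `|strand_rad pl i|.
pose lo : R := (Num.ceil (r - a - b) - 1)%:~R.
pose hi : R := (Num.floor (r - a + b) + 1)%:~R.
have hlo : lo < r - a - b by rewrite /lo -ceil_gt_int ltrBlDr ltrDl.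
have hhi : r - a + b < hi by rewrite /hi -floor_lt_int ltrDl.
near=> t => k; rewrite !ler_norml => /andP[h1 h2].
have tlo : lo < t - a - b.
  have : lo + a + b < t by near: t; apply: lt_nbhsr; lra.
  lra.
have thi : t - a + b < hi.
  have : t < hi - b + a by near: t; apply: lt_nbhsl; lra.
  lra.
have k1 : r - a - b <= k%:~R.
  have : lo < k%:~R by lra.
  by rewrite /lo ltr_int ltrBlDr ltzD1 ceil_le_int.
have k2 : k%:~R <= r - a + b.
  have : k%:~R < hi by lra.
  by rewrite /hi ltr_int ltzD1 floor_ge_int.
by apply/andP; split; lra.
Unshelve. all: by end_near. Qed.

Lemma shift_placeP i (t : R) (k : int) :
  (exists2 w, sym_itv w & (strand_comp pl i, t) = shift_pt (place pl i w) k) <->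
  `|t - k%:~R - strand_mid pl i| <= `|strand_rad pl i|.
Proof.
have r0 := rad_neq0 hpl i; have p0 : 0 < `|strand_rad pl i| by rewrite normr_gt0.
split=> [[w hw [->]]|h].
  rewrite addrK [_ + w * _]addrC addrK normrM ler_piMl// ler_norml.
  exact: hw.
exists ((t - k%:~R - strand_mid pl i) / strand_rad pl i).
  by rewrite /sym_itv /= -ler_norml normrM normfV ler_pdivrMr// mul1r.
by rewrite /shift_pt /place /= divfK// [strand_mid _ _ + _]addrC !subrK.
Qed.

Lemma near_strands (x : option 'I_n) (r : R) : \forall t \near r, forall i (k : int) w,
  sym_itv w -> (x, t) = shift_pt (place pl i w) k ->
  exists2 w', sym_itv w' & (x, r) = shift_pt (place pl i w') k.
Proof.
have h : \forall t \near r, forall i k,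
  `|t - k%:~R - strand_mid pl i| <= `|strand_rad pl i| ->
  `|r - k%:~R - strand_mid pl i| <= `|strand_rad pl i|.
  near=> t; near: t; apply: filter_forall => i; exact: strand_near.
apply: filterS h => t h i k w hw e.
have ex : x = strand_comp pl i by case: e.
rewrite ex in e *; apply/shift_placeP/h/shift_placeP.
by exists w.
Unshelve. all: by end_near. Qed.

Lemma place_inj i j v w : sym_itv v -> sym_itv w ->
  same_point (place pl i v) (place pl j w) -> i = j /\ v = w.
Proof. exact: hpl.2. Qed.

Lemma on_strandsP p : on_strands pl p ->
  exists i w k, [/\ sym_itv w, strand_comp pl i = None -> k = 0 &
    p = shift_pt (place pl i w) k].
Proof. by move=> [i [w [hw [k [hk e]]]]]; exists i, w, k. Qed.

Lemma near_off (x : option 'I_n) (r : R) : ~ on_strands pl (x, r) ->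
  \forall t \near r, ~ on_strands pl (x, t).
Proof.
move=> off; apply: filterS (near_strands x r) => t h /on_strandsP[i [w [k [hw hk e]]]].
have [w' hw' e'] := h i k w hw e; apply: off.
by exists i, w'; split=> //; exists k.
Qed.

(** Different strands are disjoint, so near a point of a strand there is no other
    strand, even beyond the end of that strand. *)
Lemma near_on i w k : sym_itv w -> (strand_comp pl i = None -> k = 0) ->
  \forall t \near (shift_pt (place pl i w) k).2,
    on_strands pl (strand_comp pl i, t) ->
    exists2 w', sym_itv w' & (strand_comp pl i, t) = shift_pt (place pl i w') k.
Proof.
move=> hw hk; set r := (shift_pt _ _).2.
apply: filterS (near_strands (strand_comp pl i) r) => t h /on_strandsP[j [v [l [hv hl e]]]].
have [v' hv' e'] := h j l v hv e.
have pp : same_point (place pl i w) (place pl j v').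
  apply: (same_point_trans (q := shift_pt (place pl i w) k)); first by exists k.
  by apply: same_point_sym; exists l; split=> //.
have [ij wv] := place_inj hw hv' pp; move: ij hl e e' => <- hl e e'.
exists v => //; rewrite e; congr shift_pt.
move: e'; rewrite /r -wv /shift_pt /= => -[] /addrI h'.
by apply/eqP; rewrite -(eqr_int R) h'.
Qed.

End NearStrands.

(** * Gluing *)

Lemma between_affine (R : realType) (a r v w y : R) : r != 0 ->
  between (a + v * r) (a + w * r) (a + y * r) = between v w y.
Proof.
move=> r0; rewrite /between !lerD2l.
have [r1|r1|r1] := ltgtP r 0; last by rewrite r1 eqxx in r0.
  by rewrite !ler_nM2r// orbC ![(_ <= y) && _]andbC.
by rewrite !ler_pM2r.
Qed.

Lemma between_dist (R : realType) (r t y e : R) : `|t - r| < e -> between r t y ->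
  `|y - r| < e.
Proof. by rewrite /between !ltr_norml; lra. Qed.

Section Glue.
Variables (R : realType) (n m : nat) (D D' : diagram R n).
Variables (phi : R * R -> 'rV[R]_3) (pl : placement R n m) (pre post : picture R m)
  (hgt : 'I_m -> R -> R) (cr cr' : crossing_table m).
Hypotheses (hphi : disk_chart phi) (hpl : placement_ok pl)
  (hsh : shows D phi pl pre hgt) (hsh' : shows D' phi pl post hgt)
  (hcr : has_crossings pre hgt cr) (hcr' : has_crossings post hgt cr').
Hypothesis heq : forall p, in_dom p -> ~ on_strands pl p ->
  ev D' p = ev D p /\ (under_pt D' p <-> under_pt D p).
Variables (T : Type) (X : quandle T) (d : T) (c : ppoint R n -> T).
Hypothesis hc : coloring D X d c.
Variable z : 'I_m -> nat -> T.
Hypothesis hz : strand_coloring X (forward pl) cr' z.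
Hypothesis z0 : forall i, z i 0%N = c (place pl i (- 1)).
Hypothesis z3 : forall i, z i 3%N = c (place pl i 1).
Implicit Types (p q o u : ppoint R n).

Lemma on_strands_coord p : on_strands pl p ->
  exists x : 'I_m * R, sym_itv x.2 /\ same_point (place pl x.1 x.2) p.
Proof. by move=> [i [w h]]; exists (i, w). Qed.

(** The coloring [c] outside the disk, completed by the zone colors [z] on the
    strands of the new picture. *)
Definition glued p : T :=
  match pselect (on_strands pl p) with
  | left H => if pselect (under_pt D' p) then d else
      let x := sval (cid (on_strands_coord H)) in z x.1 (zone x.2)
  | right _ => c p
  end.

Lemma glue_off p : ~ on_strands pl p -> glued p = c p.
Proof. by rewrite /glued; case: pselect. Qed.

Lemma glue_under p : on_strands pl p -> under_pt D' p -> glued p = d.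
Proof. by rewrite /glued; case: pselect => // ? _; case: pselect. Qed.

Lemma glue_on i w p : sym_itv w -> same_point (place pl i w) p -> ~ under_pt D' p ->
  glued p = z i (zone w).
Proof.
move=> hw h np; rewrite /glued; case: pselect => [H|[]]; last by exists i, w.
case: (pselect (under_pt D' p)) => [/np//|np']; case: cid => -[j v] /= [hv h'].
have [|-> -> //] := place_inj hpl (i := j) (j := i) hv hw.
exact: same_point_trans h' (same_point_sym h).
Qed.

Lemma sym_end (b : bool) : sym_itv ((-1) ^+ b : R).
Proof. by rewrite /sym_itv /=; case: b; rewrite ?expr0 ?expr1; lra. Qed.

Lemma end_visible i (b : bool) : ~ under_pt D (place pl i ((-1) ^+ b)).
Proof.
move/(under_place hphi hpl hsh hcr i (sym_end b)) => [k [x [e _]]].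
by have := cut_at_sym R k; rewrite -e; case: b {e} => /=; lra.
Qed.

Lemma end_visible' i (b : bool) : ~ under_pt D' (place pl i ((-1) ^+ b)).
Proof.
move/(under_place hphi hpl hsh' hcr' i (sym_end b)) => [k [x [e _]]].
by have := cut_at_sym R k; rewrite -e; case: b {e} => /=; lra.
Qed.

(** The two definitions agree at the ends of the strands, where [c] is compared
    with the end zones. *)
Lemma glue_end i (b : bool) p : same_point (place pl i ((-1) ^+ b)) p -> glued p = c p.
Proof.
move=> h; rewrite (glue_on (sym_end b) h); last first.
  by move/(under_same (same_point_sym h))/end_visible'.
case: h => k [hk ->]; rewrite (col_shift hc hk).
case: b {hk}; rewrite ?expr1 ?expr0.
  by rewrite (zone_zone_pt R (@Ordinal 4 0 isT)) z0.
by rewrite (zone_zone_pt R (@Ordinal 4 3 isT)) z3.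
Qed.

Lemma off_under p : in_dom p -> ~ on_strands pl p -> under_pt D p -> under_pt D' p.
Proof. by move=> dp op; case: (heq dp op) => _ [_ h] /h. Qed.

Lemma glue_shift p k : (p.1 = None -> k = 0) -> glued (shift_pt p k) = glued p.
Proof.
move=> hk; have pp := same_point_shift hk.
case: (pselect (on_strands pl p)) => op; last first.
  rewrite !glue_off//; first exact: (col_shift hc).
  by move/(on_same (same_point_sym pp)).
have op' := on_same pp op.
case: (pselect (under_pt D' p)) => up.
  by rewrite !glue_under//; exact: under_same pp up.
have [i [w [hw h]]] := op; rewrite (glue_on hw h up).
apply: glue_on hw (same_point_trans h pp) _.
by move/(under_same (same_point_sym pp)).
Qed.

Section LocallyConstant.
Variables (x : option 'I_n) (a b : R).
Hypotheses (da : in_dom (x, a)) (db : in_dom (x, b)) (f : free_itv D' x a b).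

Lemma between_in (r t y : R) : a <= r <= b -> a <= t <= b -> between r t y -> a <= y <= b.
Proof. by rewrite /between; lra. Qed.

Lemma glue_const_off (r t : R) : a <= r <= b -> a <= t <= b ->
  (forall y, between r t y -> y != r -> ~ on_strands pl (x, y)) ->
  ~ under_pt D (x, r) -> c (x, t) = c (x, r).
Proof.
move=> hr ht off nr; apply/esym/(constant_between (col_itv hc)).
- exact: in_dom_itv da db hr.
- exact: in_dom_itv da db ht.
move=> y hy; have hy' := between_in hr ht hy.
have [->//|yr] := eqVneq y r.
by move/(off_under (in_dom_itv da db hy') (off y hy yr)); exact: f.
Qed.

(** Away from the disk both diagrams coincide nearby, and [c] is constant on an
    interval without undercrossing. *)
Lemma glue_near_off (r : R) : a <= r <= b -> ~ on_strands pl (x, r) ->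
  \forall t \near r, a <= t <= b -> glued (x, t) = glued (x, r).
Proof.
move=> hr off; have /near_dist[e e0 he] := near_off hpl off.
apply/near_dist; exists e => // t /between_dist te ht.
have offt y : between r t y -> ~ on_strands pl (x, y) by move=> /te; exact: he.
rewrite !glue_off//; last by apply: offt; rewrite /between lexx; lra.
apply: glue_const_off => // [y hy _|]; first exact: offt.
by move/(off_under (in_dom_itv da db hr) off); exact: f.
Qed.

Lemma zone_between i v w : sym_itv v -> sym_itv w ->
  (forall y, between v w y -> ~ under_pt D' (place pl i y)) ->
  z i (zone v) = z i (zone w).
Proof.
move=> hv hw nu.
have step (k : 'I_3) : between v w (cut_at R k) -> z i k.+1 = z i k.
  move=> hk; rewrite hz; case e : (cr' i k) => [y|//].
  case: (nu _ hk); apply/(under_place hphi hpl hsh' hcr' i (sym_cut R k)).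
  by exists k, y.
case: (leP v w) => vw.
  by apply: zone_constant => // k hk; apply: step; rewrite /between hk.
apply/esym/zone_constant; first exact: ltW.
by move=> k hk; apply: step; rewrite /between hk orbT.
Qed.

(** A nearby point is on the same strand, where zone colors only change at
    undercrossings, or else beyond one end of it, where the coloring [c] of the
    old diagram continues the color of the end. *)
Lemma glue_near_on i w k : sym_itv w -> (strand_comp pl i = None -> k = 0) ->
  x = strand_comp pl i ->
  let r := (shift_pt (place pl i w) k).2 in
  a <= r <= b -> \forall t \near r, a <= t <= b -> glued (x, t) = glued (x, r).
Proof.
move=> hw hk ex r hr.
have /near_dist[e e0 he] := near_on hpl hw hk.
have r0 := rad_neq0 hpl i; have rp : 0 < `|strand_rad pl i| by rewrite normr_gt0.
pose base := strand_mid pl i + k%:~R.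
pose wt (t : R) := (t - base) / strand_rad pl i.
have wtK t : t = base + wt t * strand_rad pl i by rewrite /wt divfK// addrC subrK.
have er : r = base + w * strand_rad pl i by rewrite /r /base /=; ring.
have wr : wt r = w by rewrite /wt er [base + _]addrC addrK mulfK.
have pt v : (x, base + v * strand_rad pl i) = shift_pt (place pl i v) k.
  by rewrite /shift_pt /place /= ex /base; congr pair; ring.
have same v : same_point (place pl i v) (x, base + v * strand_rad pl i).
  by rewrite pt; exists k.
(* The margins [d1] and [d2] keep the points near an interior point of the
   strand inside the strand. *)
pose d1 := if w < 1 then 1 - w else 1; pose d2 := if - 1 < w then w + 1 else 1.
have d10 : 0 < d1 by rewrite /d1; case: ifP; lra.
have d20 : 0 < d2 by rewrite /d2; case: ifP; lra.
apply/near_dist; exists (Num.min e (Num.min d1 d2 * `|strand_rad pl i|)).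
  by rewrite lt_min e0 mulr_gt0// lt_min d10.
move=> t; rewrite lt_min => /andP[te td] ht.
have {td} : `|wt t - w| < Num.min d1 d2.
  rewrite -wr /wt -mulrBl normrM normfV ltr_pdivrMr//.
  by rewrite opprB addrA subrK.
rewrite lt_min => /andP[td1 td2].
have nur : ~ under_pt D' (x, r) by exact: f.
have nut : ~ under_pt D' (x, t) by exact: f.
have onw y : between r t y -> on_strands pl (x, y) -> sym_itv (wt y).
  move=> /(between_dist te) hy; rewrite ex => /(he _ hy) [w' hw' e'].
  suff -> : wt y = w' by [].
  move: e'; rewrite -pt -ex => -[->].
  by rewrite /wt [base + _]addrC addrK mulfK.
case: (boolP (- 1 <= wt t <= 1)) => hwt.
  rewrite (wtK t) (glue_on hwt (same _)); last by rewrite -wtK.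
  rewrite er (glue_on hw (same _)); last by rewrite -er.
  apply: zone_between => // y hy uy.
  have hy' : between r t (base + y * strand_rad pl i).
    rewrite er (wtK t) between_affine//.
    by move: hy; rewrite /between orbC.
  apply: (f (between_in hr ht hy')).
  exact: under_same (same y) uy.
(* Beyond the strand: [w] is one of the ends -1 and 1. *)
have [b' [eb eb']] : exists b' : bool, w = (-1) ^+ b' /\
   (forall v, between w (wt t) v -> v != w -> ~ sym_itv v).
  move: hwt hw td1 td2; rewrite /d1 /d2 /sym_itv /= !ltr_norml => hwt hw td1 td2.
  case: (ltP 1 (wt t)) => h.
    exists false; have w1 : w = 1 by move: td1; case: ifP => hw1; lra.
    rewrite expr0; split=> // v; rewrite /between w1 => hv vw hv'.
    by move/eqP: vw; apply; lra.
  exists true; have w1 : w = - 1 by move: td2; case: ifP => hw1; lra.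
  rewrite expr1; split=> // v; rewrite /between w1 => hv vw hv'.
  by move/eqP: vw; apply; lra.
have off y : between r t y -> y != r -> ~ on_strands pl (x, y).
  move=> hy yr oy; apply: (eb' (wt y)) (onw y hy oy).
    by rewrite -(between_affine base _ _ _ r0) -er -!wtK.
  by apply: contraNneq yr => h; rewrite (wtK y) h er.
have trr : t != r.
  apply/eqP => tr; move/negP: hwt; apply; rewrite tr wr; exact: hw.
have sr : same_point (place pl i ((-1) ^+ b')) (x, r).
  by rewrite -eb er; exact: same.
rewrite (glue_end sr) glue_off; last by apply: off => //; rewrite /between lexx; lra.
apply: glue_const_off => //.
by move/(under_same (same_point_sym sr))/end_visible.
Qed.

Lemma glue_locally_constant (r : R) : a <= r <= b ->
  \forall t \near r, a <= t <= b -> glued (x, t) = glued (x, r).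
Proof.
move=> hr; case: (pselect (on_strands pl (x, r))) => op; last exact: glue_near_off.
have [i [w [k [hw hk e]]]] := on_strandsP op.
have ex : x = strand_comp pl i by case: e.
have er : r = (shift_pt (place pl i w) k).2 by rewrite -e.
rewrite er in hr *; exact: glue_near_on.
Qed.

End LocallyConstant.

Lemma glue_interval_constant : interval_constant D' glued.
Proof.
move=> x a b ab da db f; apply: (@locally_constant_itv _ _ (fun t => glued (x, t))) => //.
by move=> r hr; exact: (glue_locally_constant da db f hr).
Qed.

Lemma velocity_off p : inner p -> ~ on_strands pl p -> velocity D' p = velocity D p.
Proof.
case: p => x r ip op; have dp := inner_in_dom ip.
apply: (@velocity_near R n D' (x, r) _ _ (is_derive_ev D dp)).
near=> t; have it : inner (x, t) by near: t; exact: near_inner ip.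
have ot : ~ on_strands pl (x, t) by near: t; exact: near_off.
by case: (heq (inner_in_dom it) ot).
Unshelve. all: by end_near. Qed.

Lemma off_crossing o u : crossing D' o u -> ~ on_strands pl o -> ~ on_strands pl u ->
  crossing D o u /\ positive_crossing D' o u = positive_crossing D o u.
Proof.
move=> [dou uu] oo ou; have [dO du ns e] := dou.
have [eo _] := heq dO oo; have [eu hu] := heq du ou.
split.
  split; last exact/hu.
  by split=> //; rewrite -[LHS]/(ev D o) -[RHS]/(ev D u) -eo -eu.
rewrite /positive_crossing !velocity_off ?eo//.
  exact: double_inner (double_point_sym dou).
exact: double_inner dou.
Qed.

Lemma zone_pt_not_under i (k : 'I_4) : ~ under_pt D' (place pl i (zone_pt R k)).
Proof.
move/(under_place hphi hpl hsh' hcr' i (zone_pt_sym R k)) => [l [y [e _]]].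
move: e; rewrite /zone_pt /cut_at.
by case: l => -[|[|[|//]]] hl; case: k => -[|[|[|[|//]]]] hk /= h; lra.
Qed.

Lemma glue_zone_pt i (k : 'I_4) : glued (place pl i (zone_pt R k)) = z i k.
Proof.
rewrite (glue_on (zone_pt_sym R k) (same_point_refl _)) ?zone_zone_pt//.
exact: zone_pt_not_under.
Qed.

(** A crossing of the new diagram has both strands in the disk or none. In the
    first case the condition is an equation on zone colors; in the second one
    the crossing belongs to the old diagram as well. *)
Lemma glue_crossing o u : crossing D' o u -> crossing_rule D' X glued o u.
Proof.
move=> cou; have [dou uu] := cou; have [dO du ns e] := dou.
case: (pselect (on_strands pl u)) => ou.
  have [i [w [hw h]]] := ou.
  have uw := under_same (same_point_sym h) uu.
  have [k [[[j k'] s] [wk ek]]] := (under_place hphi hpl hsh' hcr' i hw).1 uw.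
  rewrite wk in h.
  have [[dbl _] _] := crossing_place hphi hpl hsh' hcr' ek.
  have ho : same_point (place pl j (cut_at R k')) o.
    apply: curve_no_triple (double_point_sym dbl) _.
    exact: double_point_same (same_point_sym h) (double_point_sym dou).
  apply: (crossing_rule_same glue_shift ho h).
  apply/(crossing_rule_place hphi hpl hsh' hcr' X glue_interval_constant ek).
  have eS : (k.+1 < 4)%N by case: (k).
  have eI (l : 'I_3) : (l < 4)%N by apply: leq_trans (ltn_ord l) _.
  rewrite (glue_zone_pt i (Ordinal eS)) (glue_zone_pt i (Ordinal (eI k))).
  by rewrite (glue_zone_pt j (Ordinal (eI k'))) /= hz ek.
have oo : ~ on_strands pl o.
  by move=> oo; apply: ou; exact: (on_ev hsh' hcr' du oo).
have [cou' pos] := off_crossing cou oo ou.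
move=> a b hu da db f0.
have [e0 [e00 he]] : exists e0, 0 < e0 /\
    forall t, `|t - u.2| < e0 -> ~ on_strands pl (u.1, t).
  have ou' : ~ on_strands pl (u.1, u.2) by case: (u) ou.
  by have /near_dist[e0 h1 h2] := near_off hpl ou'; exists e0.
(* Shrink the interval so that it stays off the strands. *)
pose a0 := Num.max a (u.2 - e0 / 2); pose b0 := Num.min b (u.2 + e0 / 2).
have ha0 : a <= a0 < u.2 by rewrite /a0 le_max lexx gt_max; lra.
have hb0 : u.2 < b0 <= b by rewrite /b0 ge_min lexx lt_min; lra.
have off t : a0 <= t <= b0 -> ~ on_strands pl (u.1, t).
  rewrite /a0 /b0 ge_max le_min => ht; apply: he; rewrite ltr_norml; lra.
have da0 : in_dom (u.1, a0) by apply: (in_dom_itv da db); lra.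
have db0 : in_dom (u.1, b0) by apply: (in_dom_itv da db); lra.
apply: (@crossing_rule_local _ _ _ _ _ _ _ _ a0 b0) => //;
  [exact: glue_interval_constant|lra| |].
  by move=> r hr; apply: f0; lra.
rewrite pos !glue_off//; try by apply: off; lra.
apply: (col_cross hc) => //; first lra.
move=> r hr ru ur; apply: (f0 r) => //; first lra.
apply: off_under ur; last by apply: off.
by apply: (in_dom_itv da db); lra.
Qed.

Lemma glue_coloring : coloring D' X d glued.
Proof.
split.
- move=> p np; case: (pselect (on_strands pl p)) => op.
    apply: glue_under => //; apply: contrapT => up; apply: np; split=> //.
    exact: on_in_dom op.
  rewrite glue_off//; apply: (col_out hc) => -[dp up]; apply: np; split=> //.
  by case: (heq dp op) => _ [h _] /h.
- exact: glue_shift.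
- exact: glue_interval_constant.
- by move=> o u a b cou; exact: glue_crossing.
Qed.

End Glue.

(** * Bijections from local moves *)

Definition ends_determine (m : nat) (T : Type) (X : quandle T) (e : 'I_m -> bool)
    (cr : crossing_table m) : Prop :=
  forall z1 z2, strand_coloring X e cr z1 -> strand_coloring X e cr z2 ->
    (forall i, z1 i 0%N = z2 i 0%N) -> forall i (k : 'I_4), z1 i k = z2 i k.

Definition ends_extend (m : nat) (T : Type) (X : quandle T) (e : 'I_m -> bool)
    (cr cr' : crossing_table m) : Prop :=
  forall z, strand_coloring X e cr z -> exists z', strand_coloring X e cr' z' /\
    forall i, z' i 0%N = z i 0%N /\ z' i 3%N = z i 3%N.

Section LocalMove.
Variables (R : realType) (n m : nat).
Variables (phi : R * R -> 'rV[R]_3) (pl : placement R n m) (hgt : 'I_m -> R -> R).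
Hypotheses (hphi : disk_chart phi) (hpl : placement_ok pl).
Variables (T : Type) (X : quandle T).
Implicit Types (D : diagram R n) (p q o u : ppoint R n).

(** The left ends of the strands are included since their colors determine the
    zone colors. *)
Definition agree_outside (c c' : ppoint R n -> T) : Prop :=
  (forall p, ~ on_strands pl p -> c' p = c p) /\
  (forall i, c' (place pl i (- 1)) = c (place pl i (- 1))).

Lemma leg_off : ~ on_strands pl (leg_pt R n).
Proof.
move=> /on_strandsP[i [w [k [hw hk [ei ek]]]]].
have := hpl.1 i w hw (esym ei); rewrite (hk (esym ei)) in ek.
by rewrite /place /= addr0 in ek; rewrite -ek ltxx.
Qed.

Lemma head_off : ~ on_strands pl (head_pt R n).
Proof.
move=> /on_strandsP[i [w [k [hw hk [ei ek]]]]].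
have := hpl.1 i w hw (esym ei); rewrite (hk (esym ei)) in ek.
by rewrite /place /= addr0 in ek; rewrite -ek ltxx andbF.
Qed.

Lemma coloring_crossing_rule D d c : coloring D X d c ->
  forall o u, crossing D o u -> crossing_rule D X c o u.
Proof. by move=> hc o u cou a b; exact: (col_cross hc). Qed.

Lemma local_transfer D D' (pre post : picture R m) (cr cr' : crossing_table m) i j c :
  shows D phi pl pre hgt -> shows D' phi pl post hgt ->
  has_crossings pre hgt cr -> has_crossings post hgt cr' ->
  (forall p, in_dom p -> ~ on_strands pl p ->
     ev D' p = ev D p /\ (under_pt D' p <-> under_pt D p)) ->
  ends_extend X (forward pl) cr cr' ->
  pointed_colorings D X i j c ->
  exists2 c', pointed_colorings D' X i j c' & agree_outside c c'.
Proof.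
move=> hsh hsh' hcr hcr' heq ext [hc cl ch].
have [z' [hz' zE]] := ext _ (restrict_strand_coloring hphi hpl hsh hcr
  (col_itv hc) (coloring_crossing_rule hc)).
have z0 s : z' s 0%N = c (place pl s (- 1)) by have [-> _] := zE s.
have z3 s : z' s 3%N = c (place pl s 1) by have [_ ->] := zE s.
exists (glued D' pl i c z').
  split; rewrite ?(glue_off _ _ _ _ leg_off) ?(glue_off _ _ _ _ head_off)//.
  exact: (glue_coloring hphi hpl hsh hsh' hcr hcr' heq hc hz' z0 z3).
split=> [p op|s]; first exact: glue_off.
exact: (glue_end hphi hpl hsh' hcr' hc z0 z3 (i := s) (b := true) (same_point_refl _)).
Qed.

Lemma coloring_determined D (pic : picture R m) (cr : crossing_table m) d c c' :
  shows D phi pl pic hgt -> has_crossings pic hgt cr ->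
  ends_determine X (forward pl) cr ->
  coloring D X d c -> coloring D X d c' -> agree_outside c c' -> c' = c.
Proof.
move=> hsh hcr det hc hc' [off ends].
have hz := restrict_strand_coloring hphi hpl hsh hcr (col_itv hc)
  (coloring_crossing_rule hc).
have hz' := restrict_strand_coloring hphi hpl hsh hcr (col_itv hc')
  (coloring_crossing_rule hc').
have zz := det _ _ hz' hz ends.
apply/funext => p; case: (pselect (on_strands pl p)) => op; last exact: off.
case: (pselect (visible D p)) => vp; last by rewrite (col_out hc vp) (col_out hc' vp).
have [i [w [hw [k [hk e]]]]] := op.
have nw : ~ under_pt D (place pl i w).
  by case: vp => _ np; rewrite e in np => /(under_same (same_point_shift hk)).
rewrite e (col_shift hc hk) (col_shift hc' hk).
rewrite (strand_zone hphi hpl hsh hcr (col_itv hc) hw nw).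
rewrite (strand_zone hphi hpl hsh hcr (col_itv hc') hw nw).
exact: (zz i (Ordinal (zone_lt4 w))).
Qed.

End LocalMove.

(** Agreement outside the disk is a one-to-one correspondence: a partner exists
    by gluing, and it is unique because the left ends determine the colors in
    the disk. *)
Lemma local_move_card (R : realType) (n m : nat) (D D' : diagram R n)
    (pre post : picture R m) (hgt : 'I_m -> R -> R) (cr cr' : crossing_table m)
    (T : Type) (X : quandle T) i j :
  local_move pre post hgt D D' -> has_crossings pre hgt cr -> has_crossings post hgt cr' ->
  (forall e, ends_determine X e cr) -> (forall e, ends_determine X e cr') ->
  (forall e, ends_extend X e cr cr') -> (forall e, ends_extend X e cr' cr) ->
  (pointed_colorings D X i j #= pointed_colorings D' X i j)%card.
Proof.
move=> [phi [pl [hphi hpl hsh hsh' heq]]] hcr hcr' det det' ext ext'.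
apply: (@card_eq_rel _ _ _ _ (fun c c' : ppoint R n -> T => agree_outside pl c c')).
- by move=> c; apply: (local_transfer hphi hpl hsh hsh' hcr hcr' heq).
- move=> c hc; have [p dp op|c' hc' [h1 h2]] :=
    local_transfer hphi hpl hsh' hsh hcr' hcr _ (ext' _) hc.
    by have [-> ->] := heq p dp op.
  by exists c' => //; split=> [p /h1|s]; rewrite ?h2.
- move=> c b b' _ [hb _ _] [hb' _ _] [h1 h2] [h1' h2'].
  apply: (coloring_determined hphi hpl hsh' hcr' (det' _) hb' hb).
  by split=> [p op|s]; [rewrite (h1 p op) (h1' p op)|rewrite h2 h2'].
- move=> c c' b [hc _ _] [hc' _ _] _ [h1 h2] [h1' h2'].
  apply: (coloring_determined hphi hpl hsh hcr (det _) hc' hc).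
  by split=> [p op|s]; [rewrite -(h1 p op) -(h1' p op)|rewrite -h2 -h2'].
Qed.

(** * Pictures made of graphs *)

Definition graph_picture (R : realType) (m : nat) (y : 'I_m -> R -> R) : picture R m :=
  fun i u => (u, y i u).

(** [pr k] lists the strands that cross at [cut_at k], the one of larger slope
    first, so that the sign is positive exactly when that one passes under. *)
Definition braid_table (R : realType) (m : nat) (h : 'I_m -> R)
    (pr : 'I_3 -> option ('I_m * 'I_m)) : crossing_table m := fun i k =>
  if pr k is Some (a, b) then
    if (i == a) && (h a < h b) then Some (b, k, true)
    else if (i == b) && (h b < h a) then Some (a, k, false) else None
  else None.

Section Graphs.
Variables (R : realType) (m : nat).

Lemma is_derive_pair (f g : R -> R) (u df dg : R) : is_derive u 1 f df ->
  is_derive u 1 g dg -> is_derive u 1 (fun v : R => (f v, g v)) (df, dg).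
Proof.
move=> [hf <-] [hg <-].
have hf' : differentiable f u by exact/derivable1_diffP.
have hg' : differentiable g u by exact/derivable1_diffP.
have dp : differentiable (fun v : R => (f v, g v)) u by exact: differentiable_pair.
by split; [exact/derivable1_diffP|rewrite !deriveE// diff_pair].
Qed.

Lemma is_derive_graph (f : R -> R) (u df : R) : is_derive u 1 f df ->
  is_derive u 1 (fun v : R => (v, f v)) (1, df).
Proof. by move=> hf; exact: is_derive_pair (is_derive_id u 1) hf. Qed.

Lemma graph_crossings (y : 'I_m -> R -> R) (h : 'I_m -> R)
    (pr : 'I_3 -> option ('I_m * 'I_m)) :
  (forall i u, sym_itv u -> -1 <= y i u <= 1) ->
  (forall i j u, sym_itv u -> i != j -> y i u = y j u ->
    exists2 k : 'I_3, u = cut_at R k & pr k = Some (i, j) \/ pr k = Some (j, i)) ->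
  (forall (k : 'I_3) a b, pr k = Some (a, b) ->
    [/\ a != b, y a (cut_at R k) = y b (cut_at R k) & exists da db,
      [/\ is_derive (cut_at R k) 1 (y a) da, is_derive (cut_at R k) 1 (y b) db & db < da]]) ->
  has_crossings (graph_picture y) (fun i _ => h i) (braid_table h pr).
Proof.
move=> ybd ydbl ycross; split.
- by move=> i u hu; split=> //=; exact: ybd.
- move=> i j u v hu hv ne [uv]; move: uv ne hv => <- ne hv e hij.
  have ij : i != j by apply/eqP => ij; apply: ne; rewrite ij.
  have [k uk [ek|ek]] := ydbl i j u hu ij e; exists k, k.
    by exists true; rewrite /braid_table ek eqxx hij.
  exists false; rewrite /braid_table ek eqxx hij.
  by rewrite (negbTE ij).
- move=> i k j k' s; rewrite /braid_table; case ek : (pr k) => [[a b]|//].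
  have [ab eab [da [db [hda hdb dab]]]] := ycross k a b ek.
  case: ifP => [/andP[/eqP -> hab] [<- <- <-]|_].
    split=> //; first by move=> [/eqP]; rewrite (negbTE ab).
      by rewrite /graph_picture eab.
    exists (1, da), (1, db); split; try exact: is_derive_graph.
    by rewrite /det2 /=; apply/esym; lra.
  case: ifP => [/andP[/eqP -> hab] [<- <- <-]|//].
  split=> //; first by move=> [/esym/eqP]; rewrite (negbTE ab).
    by rewrite /graph_picture eab.
  exists (1, db), (1, da); split; try exact: is_derive_graph.
  by rewrite /det2 /=; apply/esym/negbTE; rewrite -leNgt; lra.
Qed.

End Graphs.

Section Hump.
Variable R : realType.
Implicit Types u v : R.

Lemma hump_itv u : sym_itv u -> 0 <= hump u <= 16 / 9.
Proof.
rewrite /sym_itv /hump /= => hu.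
have s1 : 0 <= 1 - u ^+ 2 <= 1 by apply/andP; split; nra.
have s2 : 0 <= (1 - u ^+ 2) ^+ 2 <= 1 by rewrite exprn_ge0 ?exprn_ile1//; lra.
lra.
Qed.

Lemma sqr_quarter u : u ^+ 2 = 1 / 4 -> u = 1 / 2 \/ u = - (1 / 2).
Proof.
move=> h; have /eqP : (u - 1 / 2) * (u + 1 / 2) = 0.
  by rewrite -[RHS](subrr (1 / 4)) -{1}h; field.
by rewrite mulf_eq0 => /orP[] /eqP ?; [left|right]; lra.
Qed.

Lemma hump_eq1 u : sym_itv u -> hump u = 1 -> u = 1 / 2 \/ u = - (1 / 2).
Proof.
rewrite /sym_itv /hump /= => hu h; apply: sqr_quarter.
have /eqP : (1 - u ^+ 2 - 3 / 4) * (1 - u ^+ 2 + 3 / 4) = 0.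
  have -> : (1 - u ^+ 2 - 3 / 4) * (1 - u ^+ 2 + 3 / 4) =
      9 / 16 * (16 / 9 * (1 - u ^+ 2) ^+ 2 - 1).
    by field.
  by rewrite h subrr mulr0.
by rewrite mulf_eq0 => /orP[] /eqP ?; nra.
Qed.

Lemma hump_eq u v : sym_itv u -> sym_itv v -> hump u = hump v -> u = v \/ u = - v.
Proof.
rewrite /sym_itv /hump /= => hu hv h.
have /eqP : (u ^+ 2 - v ^+ 2) * (2 - u ^+ 2 - v ^+ 2) = 0.
  have -> : (u ^+ 2 - v ^+ 2) * (2 - u ^+ 2 - v ^+ 2) =
    9 / 16 * (16 / 9 * (1 - v ^+ 2) ^+ 2 - 16 / 9 * (1 - u ^+ 2) ^+ 2) by field.
  by rewrite h subrr mulr0.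
rewrite mulf_eq0 => h'.
have /eqP : (u - v) * (u + v) = 0.
  have u1 : u ^+ 2 <= 1 by nra.
  have v1 : v ^+ 2 <= 1 by nra.
  by rewrite -subr_sqr; case/orP: h' => /eqP ?; lra.
by rewrite mulf_eq0 => /orP[] /eqP ?; [left|right]; lra.
Qed.

(** Clearing denominators, [hump u - 2 * u] is a multiple of
    [(2 * u - 1) * (8 * u ^+ 3 + 4 * u ^+ 2 - 14 * u - 16)], and the cubic factor
    is negative on [[0, 1]]. *)
Lemma hump_line u : sym_itv u -> hump u = 2 * u -> u = 1 / 2.
Proof.
move=> hu h; have := hump_itv hu; move: hu h; rewrite /sym_itv /= => hu h.
rewrite h => hu'; have u0 : 0 <= u by lra.
move: h; rewrite /hump => h.
have /eqP : (2 * u - 1) * (8 * u ^+ 3 + 4 * u ^+ 2 - 14 * u - 16) = 0.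
  have -> : (2 * u - 1) * (8 * u ^+ 3 + 4 * u ^+ 2 - 14 * u - 16) =
     9 * (16 / 9 * (1 - u ^+ 2) ^+ 2 - 2 * u) by field.
  by rewrite h subrr mulr0.
rewrite mulf_eq0 => /orP[] /eqP h1; first lra.
have u2 : u ^+ 2 <= u by nra.
have u3 : u ^+ 3 <= u by rewrite exprS; nra.
lra.
Qed.

Lemma humpN u : hump (- u) = hump u.
Proof. by rewrite /hump sqrrN. Qed.

Lemma is_derive_hump u : is_derive u 1 (@hump R) (- (64 / 9) * u * (1 - u ^+ 2)).
Proof.
rewrite /hump; apply: is_derive_eq; rewrite /GRing.scale /=.
by field.
Qed.

End Hump.

(** * Crossings of the Reidemeister pictures *)

Definition ord2_0 : 'I_2 := @Ordinal 2 0 isT.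
Definition ord2_1 : 'I_2 := @Ordinal 2 1 isT.
Definition ord3_0 : 'I_3 := @Ordinal 3 0 isT.
Definition ord3_1 : 'I_3 := @Ordinal 3 1 isT.
Definition ord3_2 : 'I_3 := @Ordinal 3 2 isT.

Lemma ord2_all (P : 'I_2 -> Prop) : P ord2_0 -> P ord2_1 -> forall i, P i.
Proof.
move=> h0 h1 [[|[|//]] hi].
  by rewrite (_ : Ordinal hi = ord2_0)//; exact: val_inj.
by rewrite (_ : Ordinal hi = ord2_1)//; exact: val_inj.
Qed.

Lemma ord3_all (P : 'I_3 -> Prop) : P ord3_0 -> P ord3_1 -> P ord3_2 -> forall i, P i.
Proof.
move=> h0 h1 h2 [[|[|[|//]]] hi].
- by rewrite (_ : Ordinal hi = ord3_0)//; exact: val_inj.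
- by rewrite (_ : Ordinal hi = ord3_1)//; exact: val_inj.
- by rewrite (_ : Ordinal hi = ord3_2)//; exact: val_inj.
Qed.

Definition R2_pairs (k : 'I_3) : option ('I_2 * 'I_2) :=
  nth None [:: Some (ord2_1, ord2_0); None; Some (ord2_0, ord2_1)] k.

Definition R3_pre_pairs (k : 'I_3) : option ('I_3 * 'I_3) :=
  nth None [:: Some (ord3_2, ord3_1); Some (ord3_0, ord3_1); Some (ord3_0, ord3_2)] k.

Definition R3_post_pairs (k : 'I_3) : option ('I_3 * 'I_3) :=
  nth None [:: Some (ord3_0, ord3_2); Some (ord3_0, ord3_1); Some (ord3_2, ord3_1)] k.

Definition no_crossing (m : nat) : crossing_table m := fun _ _ => None.

Definition R1_table (b : bool) : crossing_table 1 := fun i k =>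
  if k == (if b then ord3_2 else ord3_0) then
    Some (i, if b then ord3_0 else ord3_2, ~~ b) else None.

Section Shadows.
Variable R : realType.

Lemma sym_half : sym_itv (1 / 2 : R) /\ sym_itv (- (1 / 2) : R).
Proof. by rewrite /sym_itv /=; split; lra. Qed.

Lemma hump_half : hump (1 / 2 : R) = 1 /\ hump (- (1 / 2) : R) = 1.
Proof. by rewrite /hump; split; field. Qed.

Lemma R1_pre_crossings (hgt : 'I_1 -> R -> R) :
  has_crossings (@R1_pre R) hgt (@no_crossing 1).
Proof.
split=> //.
- by move=> i u hu; split=> //=; rewrite /sym_itv /=; lra.
- by move=> i j u v _ _ ne [uv]; case: ne; rewrite (ord1 i) (ord1 j) uv.
Qed.

Lemma is_derive_R1 (u : R) (i : 'I_1) : is_derive u 1 (@R1_post R i)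
  (1 - hump u + (64 / 9) * u ^+ 2 * (1 - u ^+ 2), - (32 / 9) * u * (1 - u ^+ 2)).
Proof.
have hx : is_derive u 1 (fun v : R => v * (1 - hump v))
    (1 - hump u + (64 / 9) * u ^+ 2 * (1 - u ^+ 2)).
  have := is_derive_hump u => h.
  by apply: is_derive_eq; rewrite /GRing.scale /=; field.
have hy : is_derive u 1 (fun v : R => hump v / 2) (- (32 / 9) * u * (1 - u ^+ 2)).
  have := is_derive_hump u => h.
  by apply: is_derive_eq; rewrite /GRing.scale /=; field.
exact: is_derive_pair hx hy.
Qed.

Lemma R1_post_crossings (b : bool) :
  has_crossings (@R1_post R) (fun _ u => (-1) ^+ b * u) (R1_table b).
Proof.
have [s1 s2] := sym_half; have [h1 h2] := hump_half.
have sq u : sym_itv u -> square (R1_post (ord0 : 'I_1) u).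
  move=> hu; have hh := hump_itv hu; move: hu; rewrite /square /sym_itv /= => hu.
  by split; apply/andP; split; nra.
split.
- by move=> i; rewrite (ord1 i); exact: sq.
- move=> i j u v hu hv; rewrite (ord1 i) (ord1 j) => ne [e1 e2] hlt.
  have uv : u <> v by move=> uv; apply: ne; rewrite uv.
  have huv : hump u = hump v by lra.
  case: (hump_eq hu hv huv) => // evu.
  have : u * (1 - hump u) = 0 by move: e1; rewrite -huv evu; lra.
  move=> /eqP; rewrite mulf_eq0 => /orP[/eqP u0|/eqP hu1].
    by case: uv; lra.
  have hu1' : hump u = 1 by lra.
  have [e|e] := hump_eq1 hu hu1'.
    exists ord3_2, ord3_0, false.
    case: b hlt; rewrite ?expr0 ?expr1 => hlt; last by exfalso; lra.
    by split=> //; rewrite /cut_at /=; lra.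
  exists ord3_0, ord3_2, true.
  case: b hlt; rewrite ?expr0 ?expr1 => hlt; first by exfalso; lra.
  by split=> //; rewrite /cut_at /=; lra.
move=> i k j k' s; rewrite (ord1 i) (ord1 j) /R1_table; case: eqP => // ek [<- <-].
rewrite ek; split.
- by move=> [e]; move: e; rewrite /cut_at; case: (b) => /= e; lra.
- by rewrite /R1_post /cut_at; case: (b); rewrite /= ?h1 ?h2; congr pair; lra.
- by rewrite /cut_at; case: (b); rewrite /= ?expr0 ?expr1; lra.
eexists; eexists; split; try exact: is_derive_R1.
by rewrite /det2 /cut_at; case: (b); rewrite /= ?h1 ?h2; apply/esym;
  [apply/negbTE; rewrite -leNgt|]; lra.
Qed.

Lemma R2_pre_crossings (h : 'I_2 -> R) :
  has_crossings (@R2_pre R) (fun i _ => h i) (@no_crossing 2).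
Proof.
split=> //.
- by apply: ord2_all => u hu; split=> //; rewrite /sym_itv /= ?expr0 ?expr1; lra.
- move=> i j u v _ _ ne [uv]; move: ne; rewrite -uv.
  by elim/ord2_all : i; elim/ord2_all : j => //= ne; rewrite ?expr0 ?expr1; lra.
Qed.

Lemma R2_post_crossings (h : 'I_2 -> R) :
  has_crossings (@R2_post R) (fun i _ => h i) (braid_table h R2_pairs).
Proof.
have [s1 s2] := sym_half; have [h1 h2] := hump_half.
apply: (@graph_crossings R 2 (fun i u => (-1) ^+ i * (1 - hump u) / 2)) => //.
- apply: ord2_all => u hu; have := hump_itv hu; rewrite /= ?expr0 ?expr1; lra.
- have key u : sym_itv u -> hump u = 1 -> exists2 k : 'I_3, u = cut_at R k &
     (R2_pairs k = Some (ord2_0, ord2_1)) \/ (R2_pairs k = Some (ord2_1, ord2_0)).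
    move=> hu hu1; have [e|e] := hump_eq1 hu hu1.
      by exists ord3_2; [rewrite e|left].
    by exists ord3_0; [rewrite e|right].
  apply: ord2_all; apply: ord2_all => //= u hu _; rewrite ?expr0 ?expr1 => e.
    by apply: key => //; lra.
  have [|k ek [H|H]] := key u hu; first lra.
    by exists k => //; right.
  by exists k => //; left.
have hd (k : 'I_3) (i : 'I_2) :
    is_derive (cut_at R k) 1 (fun u : R => (-1) ^+ i * (1 - hump u) / 2)
    ((-1) ^+ i * (32 / 9) * cut_at R k * (1 - cut_at R k ^+ 2)).
  have := is_derive_hump (cut_at R k) => hk.
  by apply: is_derive_eq; rewrite /GRing.scale /=; field.
apply: ord3_all => a b //= [<- <-]; split=> //.
- by rewrite /cut_at /= h2; lra.
- eexists; eexists; split; [exact: (hd ord3_0 ord2_1)|exact: (hd ord3_0 ord2_0)|].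
  by rewrite /cut_at /ord2_0 /ord2_1 /= ?expr0 ?expr1; lra.
- by rewrite /cut_at /= h1; lra.
- eexists; eexists; split; [exact: (hd ord3_2 ord2_0)|exact: (hd ord3_2 ord2_1)|].
  by rewrite /cut_at /ord2_0 /ord2_1 /= ?expr0 ?expr1; lra.
Qed.

(** [b] distinguishes the third strand before and after the move. *)
Definition R3_graph (b : bool) (i : 'I_3) (u : R) : R :=
  [:: u / 2; - (u / 2); (if b then hump u / 4 else - (hump u / 4))]`_i.

Lemma R3_crossings (h : 'I_3 -> R) (b : bool) :
  has_crossings (graph_picture (R3_graph b)) (fun i _ => h i)
    (braid_table h (if b then R3_pre_pairs else R3_post_pairs)).
Proof.
have [s1 s2] := sym_half; have [h1 h2] := hump_half.
apply: graph_crossings => //.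
- apply: ord3_all => u hu; have := hump_itv hu; rewrite /R3_graph;
    move: hu; rewrite /sym_itv; case: b => /=; lra.
- have pos u : sym_itv u -> hump u = 2 * u -> u = cut_at R ord3_2 by exact: hump_line.
  have neg u : sym_itv u -> hump u = - (2 * u) -> u = cut_at R ord3_0.
    move=> hu e; have hu' : sym_itv (- u) by move: hu; rewrite /sym_itv /=; lra.
    by have := hump_line hu'; rewrite humpN e /cut_at /= => h'; have := h' _; lra.
  have sw i j u : (exists2 k : 'I_3, u = cut_at R k &
      (if b then R3_pre_pairs else R3_post_pairs) k = Some (i, j) \/
      (if b then R3_pre_pairs else R3_post_pairs) k = Some (j, i)) ->
    exists2 k : 'I_3, u = cut_at R k &
      (if b then R3_pre_pairs else R3_post_pairs) k = Some (j, i) \/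
      (if b then R3_pre_pairs else R3_post_pairs) k = Some (i, j).
    by move=> [k ek H]; exists k => //; case: H; [right|left].
  have c01 u : sym_itv u -> R3_graph b ord3_0 u = R3_graph b ord3_1 u ->
      exists2 k : 'I_3, u = cut_at R k &
      (if b then R3_pre_pairs else R3_post_pairs) k = Some (ord3_0, ord3_1) \/
      (if b then R3_pre_pairs else R3_post_pairs) k = Some (ord3_1, ord3_0).
    rewrite /R3_graph /= => hu e; exists ord3_1; first by rewrite /cut_at /=; lra.
    by case: (b); left.
  have c02 u : sym_itv u -> R3_graph b ord3_0 u = R3_graph b ord3_2 u ->
      exists2 k : 'I_3, u = cut_at R k &
      (if b then R3_pre_pairs else R3_post_pairs) k = Some (ord3_0, ord3_2) \/
      (if b then R3_pre_pairs else R3_post_pairs) k = Some (ord3_2, ord3_0).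
    rewrite /R3_graph /= => hu e; case: (b) e => e.
      by exists ord3_2; [apply: pos => //; move: e => /=; lra|left].
    by exists ord3_0; [apply: neg => //; move: e => /=; lra|left].
  have c12 u : sym_itv u -> R3_graph b ord3_1 u = R3_graph b ord3_2 u ->
      exists2 k : 'I_3, u = cut_at R k &
      (if b then R3_pre_pairs else R3_post_pairs) k = Some (ord3_1, ord3_2) \/
      (if b then R3_pre_pairs else R3_post_pairs) k = Some (ord3_2, ord3_1).
    rewrite /R3_graph /= => hu e; case: (b) e => e.
      by exists ord3_0; [apply: neg => //; move: e => /=; lra|right].
    by exists ord3_2; [apply: pos => //; move: e => /=; lra|right].
  apply: ord3_all; apply: ord3_all => // u hu _ e.
  + exact: c01.
  + exact: c02.
  + by apply: sw; apply: c01.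
  + exact: c12.
  + by apply: sw; apply: c02.
  + by apply: sw; apply: c12.
have d0 (u : R) : is_derive u 1 (R3_graph b ord3_0) (1 / 2).
  by rewrite /R3_graph /=; apply: is_derive_eq; rewrite /GRing.scale /=; field.
have d1 (u : R) : is_derive u 1 (R3_graph b ord3_1) (- (1 / 2)).
  by rewrite /R3_graph /=; apply: is_derive_eq; rewrite /GRing.scale /=; field.
have d2 (u : R) : is_derive u 1 (R3_graph b ord3_2)
    ((if b then -1 else 1) * (16 / 9) * u * (1 - u ^+ 2)).
  have := is_derive_hump u => hk; rewrite /R3_graph /=; case: (b);
  by apply: is_derive_eq; rewrite /GRing.scale /=; field.
pose slope (i : 'I_3) (u : R) : R :=
  [:: 1 / 2; - (1 / 2); (if b then -1 else 1) * (16 / 9) * u * (1 - u ^+ 2)]`_i.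
have dd (i : 'I_3) (u : R) : is_derive u 1 (R3_graph b i) (slope i u).
  by move: i; apply: ord3_all.
have cc (k a c : 'I_3) : a != c -> R3_graph b a (cut_at R k) = R3_graph b c (cut_at R k) ->
  slope c (cut_at R k) < slope a (cut_at R k) ->
  [/\ a != c, R3_graph b a (cut_at R k) = R3_graph b c (cut_at R k) & exists da db,
      [/\ is_derive (cut_at R k) 1 (R3_graph b a) da,
          is_derive (cut_at R k) 1 (R3_graph b c) db & db < da]].
  by move=> h3 h4 h5; split=> //; eexists; eexists; split; [exact: dd|exact: dd|].
apply: ord3_all => a c; rewrite /slope in cc *; case: (b) cc => cc /= [<- <-];
  [apply: (cc ord3_0)|apply: (cc ord3_0)|apply: (cc ord3_1)|apply: (cc ord3_1)
  |apply: (cc ord3_2)|apply: (cc ord3_2)] => //;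
  rewrite /R3_graph /cut_at /= ?h1 ?h2; lra.
Qed.

End Shadows.

(** * Colorings of the Reidemeister pictures *)

Section Combinatorics.
Variables (T : Type) (X : quandle T).

Definition strand_step (m : nat) (e : 'I_m -> bool) (cr : crossing_table m)
    (k : 'I_3) (x : 'I_m -> T) : 'I_m -> T := fun i =>
  if cr i k is Some (j, _, s) then sop X (e j == s) (x i) (x j) else x i.

(** In the graph pictures of R2 and R3 two strands meet at the same parameter, so
    the colors of a zone are computed from those of the previous one. *)
Definition level (m : nat) (cr : crossing_table m) : Prop :=
  forall i k j k' s, cr i k = Some (j, k', s) -> k' = k.

Lemma level_coloring m (e : 'I_m -> bool) cr z : level cr -> strand_coloring X e cr z ->
  forall (k : 'I_3) i, z i k.+1 = strand_step e cr k (fun j => z j k) i.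
Proof.
move=> lcr hz k i; rewrite hz /strand_step; case ek : (cr i k) => [[[j k'] s]|//].
by rewrite (lcr _ _ _ _ _ ek).
Qed.

Lemma level_determine m (e : 'I_m -> bool) cr : level cr -> ends_determine X e cr.
Proof.
move=> lcr z1 z2 h1 h2 h0 i [k hk] /=.
elim: k hk i => [|k IH] hk i; first exact: h0.
have hk3 : (k < 3)%N by [].
rewrite (level_coloring lcr h1 (Ordinal hk3)) (level_coloring lcr h2 (Ordinal hk3)) /=.
by congr strand_step; apply/funext => j; apply: IH; exact: ltnW.
Qed.

Definition transfer (m : nat) (e : 'I_m -> bool) (cr : crossing_table m) (x : 'I_m -> T) :=
  strand_step e cr ord3_2 (strand_step e cr ord3_1 (strand_step e cr ord3_0 x)).

Lemma level_transfer m (e : 'I_m -> bool) cr z : level cr -> strand_coloring X e cr z ->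
  (fun i => z i 3%N) = transfer e cr (fun i => z i 0%N).
Proof.
move=> lcr hz; apply/funext => i; rewrite /transfer (level_coloring lcr hz ord3_2).
congr strand_step; apply/funext => j; rewrite (level_coloring lcr hz ord3_1).
congr strand_step; apply/funext => l; exact: (level_coloring lcr hz ord3_0).
Qed.

(** Zone colors propagate uniquely from left to right, so the only constraint on
    the ends is that the right ones be the transfer of the left ones. *)
Lemma level_extend m (e : 'I_m -> bool) cr cr' : level cr -> level cr' ->
  (forall x i, transfer e cr' x i = transfer e cr x i) -> ends_extend X e cr cr'.
Proof.
move=> lcr lcr' thr z hz; pose x i := z i 0%N.
pose x1 := strand_step e cr' ord3_0 x; pose x2 := strand_step e cr' ord3_1 x1.
pose z' i k := nth (transfer e cr' x) [:: x; x1; x2] k i.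
exists z'; split.
  move=> i; rewrite /z'; apply: ord3_all => /=.
  - rewrite /x1 /strand_step; case ek : (cr' i ord3_0) => [[[j k'] s]|//].
    by rewrite (lcr' _ _ _ _ _ ek).
  - rewrite /x2 /strand_step; case ek : (cr' i ord3_1) => [[[j k'] s]|//].
    by rewrite (lcr' _ _ _ _ _ ek).
  - rewrite /transfer -/x1 -/x2 {1}/strand_step.
    case ek : (cr' i ord3_2) => [[[j k'] s]|//].
    by rewrite (lcr' _ _ _ _ _ ek).
move=> i; split=> //; rewrite /z' /= thr.
by have /(congr1 (fun f => f i)) := level_transfer lcr hz.
Qed.

Lemma level_no_crossing m : level (@no_crossing m).
Proof. by []. Qed.

Lemma level_braid_table (R : realType) m (h : 'I_m -> R) pr : level (braid_table h pr).
Proof.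
move=> i k j k' s; rewrite /braid_table; case: (pr k) => [[a b]|//].
by case: ifP => [_ [_ <-]|_]; [|case: ifP => [_ [_ <-]|//]].
Qed.

(** The crossing of [a] and [b], [a] having the larger slope: the lower one of
    the two changes color. *)
Definition pair_step (R : realType) (m : nat) (e : 'I_m -> bool) (h : 'I_m -> R)
    (a b : 'I_m) (x : 'I_m -> T) : 'I_m -> T := fun i =>
  if (i == a) && (h a < h b) then sop X (e b) (x a) (x b)
  else if (i == b) && (h b < h a) then sop X (~~ e a) (x b) (x a) else x i.

Lemma braid_step (R : realType) m (e : 'I_m -> bool) (h : 'I_m -> R) pr k x :
  strand_step e (braid_table h pr) k x =
  if pr k is Some (a, b) then pair_step e h a b x else x.
Proof.
apply/funext => i; rewrite /strand_step /braid_table; case: (pr k) => [[a b]|//].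
rewrite /pair_step; case: ifP => [/andP[/eqP -> _]|_]; first by rewrite eqb_id.
by case: ifP => [/andP[/eqP -> _]|//]; rewrite eqbF_neg.
Qed.

(** The strand passes under itself. If the undercrossing comes first, the
    over-strand carries the color [z 1] after it, and [z 1 = z 0 |>^e z 1]
    forces [z 0 = z 1] since [z 1 |>^e z 1 = z 1]. *)
Lemma R1_constant (e : 'I_1 -> bool) b z : strand_coloring X e (R1_table b) z ->
  forall i (k : 'I_4), z i k = z i 0%N.
Proof.
move=> hz i; rewrite (ord1 i) {i}.
have e1 := hz ord0 ord3_0; have e2 := hz ord0 ord3_1; have e3 := hz ord0 ord3_2.
rewrite /R1_table /= in e1 e2 e3.
have [z1 z2 z3] : [/\ z ord0 1%N = z ord0 0%N, z ord0 2%N = z ord0 0%N &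
    z ord0 3%N = z ord0 0%N].
  case: b {hz} e1 e2 e3 => /= e1 e2 e3; first by rewrite e3 e2 e1 sop_idem.
  have e0 : z ord0 1%N = z ord0 0%N.
    by apply: (@sop_inj _ X (e ord0 == true) (z ord0 1%N)); rewrite sop_idem [LHS]e1 e2.
  by rewrite e3 e2 e0.
by case=> -[|[|[|[|//]]]].
Qed.

Lemma constant_coloring (e : 'I_1 -> bool) cr (t : T) :
  strand_coloring X e cr (fun _ _ => t).
Proof. by move=> i k; case: (cr i k) => [[[j k'] s]|//]; rewrite sop_idem. Qed.

Lemma R1_determine e b : ends_determine X e (R1_table b).
Proof.
by move=> z1 z2 h1 h2 h0 i k; rewrite (R1_constant h1) (R1_constant h2).
Qed.

Lemma R1_extend e b : ends_extend X e (@no_crossing 1) (R1_table b).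
Proof.
move=> z hz; exists (fun _ _ => z ord0 0%N); split; first exact: constant_coloring.
move=> i; rewrite (ord1 i); split=> //.
by rewrite (hz ord0 ord3_2) (hz ord0 ord3_1) (hz ord0 ord3_0).
Qed.

Lemma R1_retract e b : ends_extend X e (R1_table b) (@no_crossing 1).
Proof.
move=> z hz; exists (fun _ _ => z ord0 0%N); split; first exact: constant_coloring.
by move=> i; rewrite (ord1 i) (R1_constant hz ord0 (@Ordinal 4 3 isT)).
Qed.

(** The lower strand passes under the upper one twice, with opposite signs. *)
Lemma R2_transfer (R : realType) (h : 'I_2 -> R) e x i :
  transfer e (braid_table h R2_pairs) x i = transfer e (@no_crossing 2) x i.
Proof.
rewrite /transfer !braid_step /= /pair_step.
move: i; apply: ord2_all; rewrite /= /strand_step /=;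
  have [h01|h01|h01] := ltgtP (h ord2_0) (h ord2_1) => //=;
  by rewrite ?sopNK ?sopKN.
Qed.

(** For each order of the heights, the lowest strand passes under the two others
    in either order, meeting the middle one before or after that one has passed
    under the top strand: this is self-distributivity. *)
Lemma R3_transfer (R : realType) (h : 'I_3 -> R) e x i : injective h ->
  transfer e (braid_table h R3_pre_pairs) x i = transfer e (braid_table h R3_post_pairs) x i.
Proof.
move=> hinj; rewrite /transfer !braid_step /= /pair_step.
have n01 : h ord3_0 <> h ord3_1 by move/hinj.
have n02 : h ord3_0 <> h ord3_2 by move/hinj.
have n12 : h ord3_1 <> h ord3_2 by move/hinj.
have [h01|h01|//] := ltgtP (h ord3_0) (h ord3_1);
have [h02|h02|//] := ltgtP (h ord3_0) (h ord3_2);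
have [h12|h12|//] := ltgtP (h ord3_1) (h ord3_2); try (exfalso; lra);
move: i; apply: ord3_all => //=.
all: try by rewrite [LHS]sop_dist ?sopKN ?sopNK.
all: try by rewrite [RHS]sop_dist ?sopKN ?sopNK.

Qed.

End Combinatorics.

(** * Invariance *)

Section Invariance.
Variables (R : realType) (n : nat) (T : Type) (X : quandle T).
Implicit Types D : diagram R n.

Lemma reidemeister1_card D D' i j : reidemeister1 D D' ->
  (pointed_colorings D X i j #= pointed_colorings D' X i j)%card.
Proof.
move=> [b hm].
apply: (local_move_card i j hm (R1_pre_crossings _) (R1_post_crossings R b)) => e.
- exact/level_determine/level_no_crossing.
- exact: R1_determine.
- exact: R1_extend.
- exact: R1_retract.
Qed.

Lemma reidemeister2_card D D' i j : reidemeister2 D D' ->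
  (pointed_colorings D X i j #= pointed_colorings D' X i j)%card.
Proof.
move=> [h [_ hm]].
have l := @level_no_crossing 2; have l' := @level_braid_table R 2 h R2_pairs.
apply: (local_move_card i j hm (R2_pre_crossings h) (R2_post_crossings h)) => e.
- exact: level_determine.
- exact: level_determine.
- by apply: level_extend => // x s; exact: R2_transfer.
- by apply: level_extend => // x s; rewrite R2_transfer.
Qed.

Lemma reidemeister3_card D D' i j : reidemeister3 D D' ->
  (pointed_colorings D X i j #= pointed_colorings D' X i j)%card.
Proof.
move=> [h [hinj hm]].
have l := @level_braid_table R 3 h R3_pre_pairs; have l' := @level_braid_table R 3 h R3_post_pairs.
apply: (local_move_card i j hm (R3_crossings h true) (R3_crossings h false)) => e.
- exact: level_determine.
- exact: level_determine.
- by apply: level_extend => // x s; rewrite R3_transfer.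
- by apply: level_extend => // x s; rewrite R3_transfer.
Qed.

Lemma elementary_card D D' i j : elementary D D' ->
  (pointed_colorings D X i j #= pointed_colorings D' X i j)%card.
Proof.
case=> [/reparametrised_iso[s [rho H]]|/isotopic_iso H|[]].
- exact: iso_colorings_card H.
- exact: iso_colorings_card H.
- exact: reidemeister1_card.
- exact: reidemeister2_card.
- exact: reidemeister3_card.
Qed.

End Invariance.

Theorem theorem4p32 (R : realType) (n k : nat) (X : quandle 'I_k)
    (L L' : diagram R n) :
  linkoid_equiv L L' -> counting_matrix X L = counting_matrix X L'.
Proof.
elim=> {L L'} [D D' DD'|//|D D' _ ->//|D1 D2 D3 _ -> _ -> //].
apply/matrixP => i j; rewrite !mxE.
exact/counting_invariant_eq/elementary_card.
Qed.
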